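(* Let $k\in\hat I$. Let $\mathcal{PP}_k$ be the set of sequences $((\lambda^{(j)},\mu^{(j)}))_{j\ge1}$ with $(\lambda^{(j)},\mu^{(j)})\in\mathcal P_k^{s_k}$ for all $j$, $(\lambda^{(j)},\mu^{(j)})\ge_k(\lambda^{(j+1)},\mu^{(j+1)})$ for all $j\ge1$, and $\lambda^{(j)}=\mu^{(j)}=0$ for all but finitely many $j$ (plane $\mathbf s$-partitions). Then, as formal power series in $z_0,\dots,z_{N-1}$, $$\sum_{((\lambda^{(j)},\mu^{(j)}))_j\in\mathcal{PP}_k}\ \prod_{j\ge1}\mathrm{wt}_k(\lambda^{(j)},\mu^{(j)})=\prod_{i\le k}\ \prod_{j\ge k}\big(1-\sigma(i,j)z_{i,j}\big)^{-\sigma(i,j)},$$ i.e. this is the character of the MacMahon module $\mathcal M_k$ of $\mathcal E_{\mathbf s}$.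
   Context: Fix $m\ne n$, $N=m+n\ge3$ and a parity sequence $\mathbf s=(s_1,\dots,s_N)\in\{1,-1\}^N$ with exactly $m$ entries $1$, extended by $s_{i+N}=s_i$; $\hat I=\{0,\dots,N-1\}$; $|t|=(1-s_ts_{t+1})/2$ and $\sigma(i,j)=(-1)^{\sum_{t=i}^j|t|}$ for integers $i\le j$. Formal variables $z_0,\dots,z_{N-1}$, $z_{t+N}=z_t$, $z_{i,j}=\prod_{t=i}^jz_t$. For $k\in\mathbb Z$, $\epsilon\in\{1,-1\}$, $\mathcal P_k^\epsilon$ is the set of pairs $(\lambda,\mu)$ of weakly decreasing sequences of non-negative integers $\lambda=(\lambda_1,\lambda_2,\dots)$, $\mu=(\mu_1,\mu_2,\dots)$, finitely many nonzero, such that: $\mu_j=0$ whenever $\lambda_j=0$; $\lambda_j=\lambda_{j+1}$ only if $s_{k+\lambda_j}=\epsilon$ or $\lambda_j=\mu_j=0$; $\mu_j=\mu_{j+1}$ only if $s_{k-\mu_j}=\epsilon$ or $\mu_j=\lambda_{j+1}=0$. $\ell(\lambda)$ denotes the number of nonzero entries. $\mathrm{wt}_k(\lambda,\mu)=\prod_{j\ge1}\prod_{t=0}^{\lambda_j-1}z_{k+t}\cdot\prod_{j\ge1}\prod_{t=1}^{\mu_j}z_{k-t}$ (counts boxes of each colour mod $N$). For two such pairs, $(\lambda^{(1)},\mu^{(1)})\ge_k(\lambda^{(2)},\mu^{(2)})$ means: $\ell(\lambda^{(2)})\le\ell(\mu^{(1)})$, $\ell(\lambda^{(2)})\le\ell(\lambda^{(1)})$,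 $\ell(\mu^{(2)})\le\ell(\mu^{(1)})$; for $i=1,\dots,\ell(\lambda^{(2)})$, $\lambda^{(1)}_i\ge\lambda^{(2)}_i$ with equality allowed only if $s_{\lambda^{(1)}_i+k}=-s_k$ or $\lambda^{(1)}_i=0$; for $i=1,\dots,\ell(\mu^{(2)})$, $\mu^{(1)}_i\ge\mu^{(2)}_i$ with equality allowed only if $s_{-\mu^{(1)}_i+k}=-s_k$ or $\mu^{(1)}_i=0$. The set $\mathcal{PP}_k$ indexes a basis of the MacMahon module $\mathcal M_k$, whose grading counts boxes of each colour (highest weight vector of degree 1). *)

(* Defs.v *)
From mathcomp Require Import all_boot all_order all_algebra.
Import GRing.Theory Num.Theory.
Local Open Scope ring_scope.

(* A monomial is its exponent vector; a formal power series is its coefficient function. *)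
Definition mon (N : nat) := {ffun 'I_N -> nat}.
Definition fps (N : nat) := mon N -> int.

Definition mzero N : mon N := [ffun _ => 0%N].
Definition madd N (a b : mon N) : mon N := [ffun i => (a i + b i)%N].
Definition msub N (d a : mon N) : mon N := [ffun i => (d i - a i)%N].
Definition mscale N (r : nat) (a : mon N) : mon N := [ffun i => (r * a i)%N].
Definition mdeg N (d : mon N) : nat := (\sum_(i < N) d i)%N.
Definition mle N (a d : mon N) : bool := [forall i, (a i <= d i)%N].

(* all monomials dividing d (each listed once) *)
Definition below N (d : mon N) : seq (mon N) :=
  [seq a <- [seq ([ffun i => nat_of_ord (f i)] : mon N)
              | f : {ffun 'I_N -> 'I_(mdeg N d).+1}] | mle N a d].

Definition fps_one N : fps N := fun d => ((d == mzero N) : nat)%:Z.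
Definition fps_mul N (f g : fps N) : fps N :=
  fun d => (\sum_(a <- below N d) f a * g (msub N d a))%R.
Definition fps_prod N (fs : seq (fps N)) : fps N := foldr (@fps_mul N) (fps_one N) fs.

(* integer t has colour c : 'I_N iff t = c mod N  (z_{t+N} = z_t) *)
Definition color_eq N (t : int) (c : 'I_N) : bool := ((t %% N%:Z)%Z == (c : nat)%:Z).

(* exponent vector of z_{i,j} = prod_{t=i}^{j} z_t  (for i <= j) *)
Definition zmon N (i j : int) : mon N :=
  [ffun c => count (fun u : nat => color_eq N (i + u%:Z) c) (iota 0 (absz (j - i)).+1)].

(* parity sequence s : int -> bool, s t = true meaning s_t = 1, false meaning s_t = -1 *)
(* |t| = (1 - s_t s_{t+1})/2 is 1 iff s_t <> s_{t+1} *)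
Definition bar (s : int -> bool) (t : int) : bool := s t != s (t + 1).
(* sigma(i,j) = (-1)^{sum_{t=i}^{j} |t|}  (for i <= j) *)
Definition sigma (s : int -> bool) (i j : int) : int :=
  ((-1) ^+ count (fun u : nat => bar s (i + u%:Z)) (iota 0 (absz (j - i)).+1))%R.

(* the factor (1 - sigma(i,j) z_{i,j})^{-sigma(i,j)} :
   if sigma = 1 it is (1 - z_{i,j})^{-1} = sum_{r>=0} z_{i,j}^r,
   if sigma = -1 it is (1 + z_{i,j})^1. *)
Definition factor N (s : int -> bool) (i j : int) : fps N :=
  fun d => let e := zmon N i j in
  if sigma s i j == 1%R then
    ([exists r : 'I_(mdeg N d).+1, d == mscale N (r : nat) e] : nat)%:Z
  else (((d == mzero N) || (d == e)) : nat)%:Z.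

(* partial product over the finitely many pairs i <= k <= j with j - i + 1 <= L *)
Definition pairsL (L : nat) : seq (nat * nat) :=
  [seq ab <- [seq (a, b) | a <- iota 0 L, b <- iota 0 L] | (ab.1 + ab.2 < L)%N].
Definition rhs_partial N (s : int -> bool) (k : int) (L : nat) : fps N :=
  fps_prod N [seq factor N s (k - (ab.1)%:Z) (k + (ab.2)%:Z) | ab <- pairsL L].

(* a weakly decreasing sequence of non-negative integers with finitely many nonzero
   entries is represented by the list of its nonzero entries; entry lambda_j (j>=1)
   is nth 0 lam (j-1), and l(lambda) = size lam. *)
Definition is_part (l : seq nat) : bool := all (fun x => 0 < x)%N l && sorted geq l.

Definition in_P (s : int -> bool) (k : int) (eps : bool) (lam mu : seq nat) : Prop :=
  [/\ is_part lam, is_part mu,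
      (forall j, nth 0%N lam j = 0%N -> nth 0%N mu j = 0%N),
      (forall j, nth 0%N lam j = nth 0%N lam j.+1 ->
          s (k + (nth 0%N lam j)%:Z) = eps \/ (nth 0%N lam j = 0%N /\ nth 0%N mu j = 0%N))
    & (forall j, nth 0%N mu j = nth 0%N mu j.+1 ->
          s (k - (nth 0%N mu j)%:Z) = eps \/ (nth 0%N mu j = 0%N /\ nth 0%N lam j.+1 = 0%N))].

Definition ge_k (s : int -> bool) (k : int) (p1 p2 : seq nat * seq nat) : Prop :=
  let: (l1, m1) := p1 in let: (l2, m2) := p2 in
  [/\ (size l2 <= size m1)%N, (size l2 <= size l1)%N, (size m2 <= size m1)%N,
      (forall i, (i < size l2)%N ->
         (nth 0%N l2 i <= nth 0%N l1 i)%N /\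
         (nth 0%N l1 i = nth 0%N l2 i ->
            s ((nth 0%N l1 i)%:Z + k) = ~~ s k \/ nth 0%N l1 i = 0%N))
    & (forall i, (i < size m2)%N ->
         (nth 0%N m2 i <= nth 0%N m1 i)%N /\
         (nth 0%N m1 i = nth 0%N m2 i ->
            s (k - (nth 0%N m1 i)%:Z) = ~~ s k \/ nth 0%N m1 i = 0%N))].

Definition wt N (k : int) (lam mu : seq nat) : mon N :=
  [ffun c => ((\sum_(l <- lam) count (fun t : nat => color_eq N (k + t%:Z) c) (iota 0 l))
            + (\sum_(x <- mu) count (fun t : nat => color_eq N (k - t%:Z) c) (iota 1 x)))%N].

(* A plane s-partition ((lam^(j), mu^(j)))_{j>=1} is represented by the finite list of
   its nonzero terms (the j-th term is nth j-1 with default ([::],[::])). *)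
Definition plane := seq (seq nat * seq nat).
Definition zpair : seq nat * seq nat := ([::], [::]).

Definition is_PP (s : int -> bool) (k : int) (P : plane) : Prop :=
  [/\ (forall p, p \in P -> p != zpair),
      (forall j, in_P s k (s k) (nth zpair P j).1 (nth zpair P j).2)
    & (forall j, ge_k s k (nth zpair P j) (nth zpair P j.+1))].

Definition wtPP N (k : int) (P : plane) : mon N :=
  foldr (fun p acc => madd N (wt N k p.1 p.2) acc) (mzero N) P.

(* Main.v *)
(**
  For each u let A_u be the partition whose j-th row counts the entries of
  lambda^(j) exceeding u; likewise let B_(v+1) count the entries of mu^(j)
  exceeding v, and put B_0 = A_0. The conditions defining plane s-partitions say
  exactly that A_u / A_(u+1) and B_v / B_(v+1) are horizontal strips when
  s_(k+u+1) = s_k, respectively s_(k-v) = s_k, and vertical strips otherwise.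
  So a plane s-partition is the boundary of a growth diagram G on N x N, and the
  local rules (reflection of rows for two strips of the same kind, a travelling
  carry bit for strips of different kinds) turn the boundary bijectively into an
  array n(u,v) of non-negative integers, finitely supported, with n(u,v) <= 1 at
  the cells where the two kinds differ, that is where sigma(k-v,k+u) = -1. As
  |G(u,v)| is the sum of n over the quadrant beyond (u,v), the weight of the
  plane partition is the product of the z_(k-v,k+u)^n(u,v), and the generating
  function of the arrays n is the product over the cells (u,v).
*)
Require Import Defs.
From mathcomp Require Import all_boot all_order all_algebra zify.
From Stdlib Require Import ClassicalEpsilon FunctionalExtensionality.

Local Notation entry := (nth 0%N).

(** * Partitions and conjugation *)

Lemma is_part_cons x l :
  is_part (x :: l) = [&& (0 < x)%N, (entry l 0 <= x)%N & is_part l].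
Proof.
rewrite /is_part /=; case: l => [|y l] /=; first by rewrite !andbT.
by rewrite /geq /=; case: (0 < x)%N; case: (0 < y)%N; case: (y <= x)%N; rewrite //= ?andbF.
Qed.

Lemma part_dec l : is_part l -> forall i, (entry l i.+1 <= entry l i)%N.
Proof.
elim: l => [|x l IH] //; rewrite is_part_cons => /and3P[_ hx /IH hl] [|i] //=.
Qed.

Lemma entry_gt0 l i : is_part l -> (0 < entry l i)%N = (i < size l)%N.
Proof.
move=> /andP[/allP hp _]; case: (ltnP i (size l)) => hi; first by have := hp _ (mem_nth 0%N hi).
by rewrite nth_default.
Qed.

Lemma part_ext l1 l2 : is_part l1 -> is_part l2 ->
  (forall i, entry l1 i = entry l2 i) -> l1 = l2.
Proof.
move=> h1 h2 e; apply: (@eq_from_nth _ 0%N) => [|i _]; last exact: e.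
apply/eqP; rewrite eqn_leq; apply/andP; split; rewrite leqNgt; apply/negP => h.
  by move: h; rewrite -entry_gt0 // e entry_gt0 // ltnn.
by move: h; rewrite -entry_gt0 // -e entry_gt0 // ltnn.
Qed.

(** Shapes given by formulas for their rows become lists through this lemma; [M] may be any index
    where [f] vanishes, since [f] then stays zero. *)
Lemma part_of_fun (f : nat -> nat) M :
  (forall i, f i.+1 <= f i)%N -> f M = 0%N ->
  exists2 l, is_part l & forall i, entry l i = f i.
Proof.
elim: M f => [|M IH] f hd h0.
  exists [::] => // i; rewrite nth_nil; elim: i => [|i IHi] //.
  by have := hd i; rewrite -IHi; lia.
case: (IH (fun i => f i.+1)) => // l hl el.
case: (posnP (f 0%N)) => h.
  exists [::] => // i; rewrite nth_nil; elim: i => [|i IHi] //.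
  by have := hd i; rewrite -IHi; lia.
by exists (f 0%N :: l) => [|[|i] //=]; rewrite is_part_cons h hl el hd.
Qed.

Lemma sumn_entries l M : (size l <= M)%N -> sumn l = (\sum_(i < M) entry l i)%N.
Proof.
elim: l M => [|x l IH] M; first by move=> _; rewrite big1 // => i _; rewrite nth_nil.
by case: M => // M hM; rewrite big_ord_recl /= (IH M).
Qed.

Definition conjp (l : seq nat) : seq nat :=
  mkseq (fun j => count (ltn j) l) (entry l 0).

(** In a weakly decreasing list the entries exceeding [j] form a prefix, and the count is the length
    of that prefix. *)
Lemma lt_conj l i j : is_part l -> (i < count (ltn j) l)%N = (j < entry l i)%N.
Proof.
elim: l i => [|x l IH] i; first by rewrite nth_nil.
rewrite is_part_cons => /and3P[hx hl pl] /=.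
case: i => [|i]; rewrite [nth _ _ _]/=; have h0 := IH 0%N pl; last have := IH i pl.
  by case: (ltnP j x) => h; lia.
by case: (ltnP j x) => h; lia.
Qed.

Lemma entry_conj l j : is_part l -> entry (conjp l) j = count (ltn j) l.
Proof.
move=> pl; case: (ltnP j (entry l 0)) => h; first by rewrite nth_mkseq.
rewrite nth_default ?size_mkseq //.
by have := lt_conj l 0%N j pl; lia.
Qed.

Lemma conjP l i j : is_part l -> (i < entry (conjp l) j)%N = (j < entry l i)%N.
Proof. by move=> pl; rewrite entry_conj // lt_conj. Qed.

Lemma conj_part l : is_part l -> is_part (conjp l).
Proof.
move=> pl.
have [||l' pl' e] := @part_of_fun (fun j => count (ltn j) l) (entry l 0).
- by move=> j; apply: sub_count => x /=; lia.
- by have := lt_conj l 0%N (entry l 0) pl; lia.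
suff -> : conjp l = l' by [].
apply: (@eq_from_nth _ 0%N) => [|i _]; last by rewrite entry_conj.
rewrite size_mkseq.
have h i : (i < entry l 0)%N = (i < size l')%N.
  by rewrite -entry_gt0 // e lt_conj.
by have := h (entry l 0); have := h (size l'); lia.
Qed.

Lemma conjK l : is_part l -> conjp (conjp l) = l.
Proof.
move=> pl; apply: part_ext => // [|i]; first by do 2!apply: conj_part.
have h j : (j < entry (conjp (conjp l)) i)%N = (j < entry l i)%N.
  by rewrite conjP ?conj_part // conjP.
by have := h (entry l i); have := h (entry (conjp (conjp l)) i); lia.
Qed.

Lemma conj_inj a b : is_part a -> is_part b -> conjp a = conjp b -> a = b.
Proof. by move=> pa pb e; rewrite -(conjK a pa) e conjK. Qed.

Lemma sum_ltn x X : (\sum_(j < X) (j < x)%N)%N = minn x X.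
Proof.
elim: X => [|X IH]; first by rewrite big_ord0 minn0.
by rewrite big_ord_recr /= IH; lia.
Qed.

Lemma sumn_conj l : is_part l -> sumn (conjp l) = sumn l.
Proof.
move=> pl; rewrite (sumn_entries _ (entry l 0)) ?size_mkseq //.
under eq_bigr do rewrite entry_conj //.
have : all (fun x => x <= entry l 0)%N l.
  elim: l {pl}(pl : is_part l) => [|x l IH] //; rewrite is_part_cons => /and3P[_ hx pl].
  rewrite /= leqnn /=; apply/allP => y hy; apply: leq_trans hx.
  by move/allP: (IH pl); apply.
move: (entry l 0) => X; elim: l {pl} => [|x l IH] /=.
  by move=> _; rewrite big1.
by case/andP=> hx /IH e; rewrite big_split /= e sum_ltn; lia.
Qed.

(** * Local rules *)

Definition hstrip (a b : seq nat) := forall i, (entry a i.+1 <= entry b i <= entry a i)%N.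
Definition vstrip (a b : seq nat) := forall i, (entry b i <= entry a i <= (entry b i).+1)%N.
Definition strip (p : bool) a b := if p then hstrip a b else vstrip a b.

(** Each inequality is refuted by testing the other family at the length of the row or column where
    it would fail. *)
Lemma hstrip_conj a b : is_part a -> is_part b -> hstrip (conjp a) (conjp b) <-> vstrip a b.
Proof.
move=> pa pb; split=> h i; apply/andP; split; rewrite leqNgt; apply/negP => hi.
- have [_ hx] := andP (h (entry a i)).
  by move: hi; rewrite -conjP // => /leq_trans/(_ hx); rewrite conjP // ltnn.
- have [hx _] := andP (h (entry b i)).
  by move: hi; rewrite -conjP // => /leq_trans/(_ hx); rewrite conjP // ltnn.
- move: hi; rewrite conjP // => hi; have := h (entry (conjp b) i).
  have := conjP b (entry (conjp b) i) i pb; rewrite ltnn.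
  have := part_dec a pa (entry (conjp b) i); have := conjP a (entry (conjp b) i).+1 i.+1 pa.
  have := h (entry (conjp b) i).+1. lia.
- have := h (entry (conjp a) i); have := conjP a (entry (conjp a) i) i pa; rewrite ltnn.
  by move: hi; rewrite conjP //; lia.
Qed.

Lemma vstrip_conj a b : is_part a -> is_part b -> vstrip (conjp a) (conjp b) <-> hstrip a b.
Proof. by move=> pa pb; rewrite -hstrip_conj ?conj_part // !conjK. Qed.

(* Given tau and rho, row i.+1 of kap and row i of nu range over the same interval;
   the rule reflects one in it, and n is the excess of the first row of kap. *)
Definition rule_hh (kap tau rho nu : seq nat) n :=
  entry kap 0 = (maxn (entry tau 0) (entry rho 0) + n)%N /\
  forall i, (entry kap i.+1 + entry nu i =
    maxn (entry tau i.+1) (entry rho i.+1) + minn (entry tau i) (entry rho i))%N.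

(* c is a carry bit: it is added to row i of kap and reloaded with the cell removed
   from row i of nu, except in rows where both moves are forced. *)
Definition rule_hv (kap tau rho nu : seq nat) n :=
  exists2 c : nat -> nat, c 0%N = n &
  forall i, (c i <= 1)%N /\
    if (entry tau i <= entry rho i)%N
    then entry kap i = (entry rho i + c i)%N /\ entry tau i = (entry nu i + c i.+1)%N
    else entry kap i = (entry rho i).+1 /\ entry tau i = (entry nu i).+1 /\ c i.+1 = c i.

Definition rule (p q : bool) kap tau rho nu n :=
  match p, q with
  | true, true => rule_hh kap tau rho nu n
  | true, false => rule_hv kap tau rho nu n
  | false, true => rule_hv kap rho tau nu n
  | false, false => rule_hh (conjp kap) (conjp tau) (conjp rho) (conjp nu) n
  end.

(** A unit square of the growth diagram: [kap] is the corner nearest the origin and the largest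
    shape, [nu] the opposite one. Opposite sides carry strips of the same kind. *)
Record cell (p q : bool) kap tau rho nu n : Prop := Cell {
  cell_pk : is_part kap; cell_pt : is_part tau;
  cell_pr : is_part rho; cell_pn : is_part nu;
  cell_kt : strip p kap tau; cell_kr : strip q kap rho;
  cell_tn : strip q tau nu; cell_rn : strip p rho nu;
  cell_rule : rule p q kap tau rho nu n }.

Lemma cell_sym p q kap tau rho nu n :
  cell p q kap tau rho nu n -> cell q p kap rho tau nu n.
Proof.
case: p; case: q => -[pk pt pr pn kt kr tn rn ru]; split=> //.
- by case: ru => e0 e; split=> [|i]; rewrite maxnC // minnC.
- by case: ru => e0 e; split=> [|i]; rewrite maxnC // minnC.
Qed.

Lemma cell_conj p kap tau rho nu n :
  cell p p kap tau rho nu n -> cell (~~ p) (~~ p) (conjp kap) (conjp tau) (conjp rho) (conjp nu) n.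
Proof.
case: p => -[pk pt pr pn kt kr tn rn ru]; split; rewrite ?conj_part //=;
  rewrite ?hstrip_conj ?vstrip_conj ?conjK //.
Qed.

(** * Existence of the missing corner of a cell *)

Lemma cell_fwd_hh kap tau rho : is_part kap -> is_part tau -> is_part rho ->
  hstrip kap tau -> hstrip kap rho ->
  exists nu n, cell true true kap tau rho nu n.
Proof.
move=> pk pt pr kt kr.
have [|| nu pn e] := @part_of_fun (fun i => maxn (entry tau i.+1) (entry rho i.+1) +
   minn (entry tau i) (entry rho i) - entry kap i.+1)%N (size kap).
- move=> i; have := kt i; have := kt i.+1; have := kr i; have := kr i.+1.
  have := kt i.+2; have := kr i.+2; lia.
- have := kt (size kap); have := kr (size kap); have := kt (size kap).+1.
  have := kr (size kap).+1; rewrite !(@nth_default _ _ kap); lia.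
exists nu, (entry kap 0 - maxn (entry tau 0) (entry rho 0))%N.
split=> //= [i|i|].
- by have := kt i; have := kt i.+1; have := kr i; have := kr i.+1; rewrite e; lia.
- by have := kt i; have := kt i.+1; have := kr i; have := kr i.+1; rewrite e; lia.
split=> [|i]; first by have := kt 0%N; have := kr 0%N; lia.
by have := kt i; have := kt i.+1; have := kr i; have := kr i.+1; rewrite e; lia.
Qed.

Lemma cell_bwd_hh tau rho nu n : is_part tau -> is_part rho -> is_part nu ->
  hstrip tau nu -> hstrip rho nu ->
  exists kap, cell true true kap tau rho nu n.
Proof.
move=> pt pr pn tn rn.
(* Row 0 of [kap] is not the reflection of any row of [nu] and takes [n] instead. The bound is a
   successor so that it is never row 0, which may be nonzero. *)
have [|| kap pk e] := @part_of_fun (fun i => if i is i'.+1 then maxn (entry tau i) (entry rho i) +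
   minn (entry tau i') (entry rho i') - entry nu i' else maxn (entry tau 0) (entry rho 0) + n)%N
   (size tau + size rho).+1.
- by case=> [|i]; [have := tn 0%N; have := rn 0%N | have := tn i; have := rn i;
    have := tn i.+1; have := rn i.+1]; lia.
- rewrite !(@nth_default _ _ tau) ?(@nth_default _ _ rho); lia.
exists kap; split=> //= [i|i|].
- by case: i => [|i]; rewrite !e; [have := tn 0%N; have := rn 0%N |
    have := tn i; have := rn i; have := tn i.+1; have := rn i.+1]; lia.
- by case: i => [|i]; rewrite !e; [have := tn 0%N; have := rn 0%N |
    have := tn i; have := rn i; have := tn i.+1; have := rn i.+1]; lia.
by split=> [|i]; rewrite e //; have := tn i; have := rn i; lia.
Qed.

Lemma cell_fwd_hv kap tau rho : is_part kap -> is_part tau -> is_part rho ->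
  hstrip kap tau -> vstrip kap rho ->
  exists nu n, cell true false kap tau rho nu n.
Proof.
move=> pk pt pr kt kr.
pose M := size kap.
(* The carry is reconstructed from the bottom, because its value at row 0 is the unknown [n]: [h t]
   is the carry of row [M - t], zero at row [M] where [kap] has ended. *)
pose h := fix h t := if t is t'.+1 then
   if (entry tau (M - t) <= entry rho (M - t))%N then (entry kap (M - t) - entry rho (M - t))%N else h t'
   else 0%N.
pose c i := h (M - i)%N.
have zk i : (M <= i)%N -> entry kap i = 0%N by move=> ?; rewrite nth_default.
have ce i : c i = if (entry tau i <= entry rho i)%N then (entry kap i - entry rho i)%N else c i.+1.
  rewrite /c; case: (ltnP i M) => hi.
    have -> : (M - i = (M - i.+1).+1)%N by lia.
    by rewrite /=; have -> : (M - (M - i.+1).+1 = i)%N by lia.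
  have -> : (M - i = 0)%N by lia. have -> : (M - i.+1 = 0)%N by lia.
  by have := kt i; have := kr i; have := zk i hi; case: ifP => //= ?; lia.
have c1 i : (c i <= 1)%N.
  case: (leqP i M) => hi; last by rewrite /c; have -> : (M - i = 0)%N by lia.
  have -> : i = (M - (M - i))%N by lia.
  elim: (M - i)%N => [|t IH]; first by rewrite /c subn0 subnn.
  case: (ltnP t M) => ht; last by have <- : (M - t = M - t.+1)%N by lia.
  rewrite ce; have -> : (M - t.+1).+1 = (M - t)%N by lia.
  by case: ifP => // _; have := kr (M - t.+1)%N; lia.
pose f i := (if entry tau i <= entry rho i then entry tau i - c i.+1 else (entry tau i).-1)%N.
(* These bounds give both strips ending at [nu]; the last one says that the subtraction
   [entry tau i - c i.+1] is not truncated. If row [i] of [tau] is longer than that of [rho], the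
   strips starting at [kap] force it to be longer by one and equal to that of [kap]. *)
have fb i : (entry rho i.+1 <= f i <= entry rho i)%N /\ (f i <= entry tau i <= (f i).+1)%N
   /\ (entry tau i <= entry rho i -> entry tau i = f i + c i.+1)%N.
  rewrite /f; have := ce i.+1; have := c1 i.+1; have := c1 i.+2.
  have := kt i; have := kt i.+1; have := kr i; have := kr i.+1.
  have := part_dec _ pt i; have := part_dec _ pr i.
  by case: (leqP (entry tau i) (entry rho i)) => ?; case: (leqP (entry tau i.+1) (entry rho i.+1)) => ?; lia.
have [|| nu pn e] := @part_of_fun f M.
- by move=> i; have := fb i; have := fb i.+1; lia.
- by have := fb M; have := kr M; have := zk M (leqnn _); lia.
exists nu, (c 0%N).
split=> //= [i|i|].
- by rewrite e; have := fb i; lia.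
- by rewrite e; have := fb i; lia.
exists c => // i; split=> //; have := ce i; have := fb i; have := kr i; have := kt i.
rewrite e /f; case: (leqP (entry tau i) (entry rho i)) => h1 h2 h3 h4 h5; split; lia.
Qed.

(** Here the carry is known at the top, where it is [n], and is computed downwards; [n <= 1] makes
    every carry a bit. *)
Lemma cell_bwd_hv tau rho nu n : is_part tau -> is_part rho -> is_part nu ->
  vstrip tau nu -> hstrip rho nu -> (n <= 1)%N ->
  exists kap, cell true false kap tau rho nu n.
Proof.
move=> pt pr pn tn rn n1.
pose c := fix c i := if i is i'.+1 then
   if (entry tau i' <= entry rho i')%N then (entry tau i' - entry nu i')%N else c i' else n.
have c1 i : (c i <= 1)%N.
  by elim: i => [|i IH] //=; case: ifP => // _; have := tn i; lia.
pose f i := if (entry tau i <= entry rho i)%N then (entry rho i + c i)%N else (entry rho i).+1.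
have ce i : c i.+1 = if (entry tau i <= entry rho i)%N then (entry tau i - entry nu i)%N else c i by [].
have fb i : (f i.+1 <= entry tau i <= f i)%N /\ (entry rho i <= f i <= (entry rho i).+1)%N.
  rewrite /f; have := c1 i; have := c1 i.+1; have := ce i.
  have := tn i; have := tn i.+1; have := rn i; have := rn i.+1.
  have := part_dec _ pt i; have := part_dec _ pr i.
  by case: (leqP (entry tau i) (entry rho i)) => ?; case: (leqP (entry tau i.+1) (entry rho i.+1)) => ?; lia.
have [|| kap pk e] := @part_of_fun f (size tau + size rho).+1.
- by move=> i; have := fb i; have := fb i.+1; lia.
- set M := (_ + _)%N; have := fb M; rewrite (@nth_default _ _ tau); lia.
exists kap; split=> //= [i|i|].
- by rewrite !e; have := fb i; lia.
- by rewrite !e; have := fb i; lia.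
exists c => // i; split=> //; rewrite e /f; have := ce i; have := tn i; have := rn i.
case: (leqP (entry tau i) (entry rho i)) => h1 h2 h3 h4; split; lia.
Qed.

Lemma cell_fwd p q kap tau rho : is_part kap -> is_part tau -> is_part rho ->
  strip p kap tau -> strip q kap rho ->
  exists nu n, cell p q kap tau rho nu n.
Proof.
move=> pk pt pr; case: p; case: q => kt kr.
- exact: cell_fwd_hh.
- exact: cell_fwd_hv.
- have [nu [n /cell_sym h]] := cell_fwd_hv kap rho tau pk pr pt kr kt.
  by exists nu, n.
- have [|||||nu [n h]] := cell_fwd_hh (conjp kap) (conjp tau) (conjp rho);
    rewrite ?conj_part ?hstrip_conj //.
  by exists (conjp nu), n; move/cell_conj: h; rewrite !conjK.
Qed.

Lemma cell_bwd p q tau rho nu n : is_part tau -> is_part rho -> is_part nu ->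
  strip q tau nu -> strip p rho nu -> (p != q -> n <= 1)%N ->
  exists kap, cell p q kap tau rho nu n.
Proof.
move=> pt pr pn; case: p; case: q => tn rn n1.
- exact: cell_bwd_hh.
- by apply: cell_bwd_hv => //; apply: n1.
- have [|kap /cell_sym h] := cell_bwd_hv rho tau nu n pr pt pn rn tn; first exact: n1.
  by exists kap.
- have [|||||kap h] := cell_bwd_hh (conjp tau) (conjp rho) (conjp nu) n;
    rewrite ?conj_part ?hstrip_conj //.
  by exists (conjp kap); move/cell_conj: h; rewrite !conjK.
Qed.

(** * Uniqueness of the missing corner of a cell *)

Lemma rule_hh_fwd_inj kap tau rho nu n nu' n' : is_part nu -> is_part nu' ->
  rule_hh kap tau rho nu n -> rule_hh kap tau rho nu' n' -> nu = nu' /\ n = n'.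
Proof.
move=> pn pn' [e0 e] [e0' e']; split; last by lia.
by apply: part_ext => // i; have := e i; have := e' i; lia.
Qed.

Lemma rule_hh_bwd_inj kap tau rho nu n kap' : is_part kap -> is_part kap' ->
  rule_hh kap tau rho nu n -> rule_hh kap' tau rho nu n -> kap = kap'.
Proof.
move=> pk pk' [e0 e] [e0' e'].
by apply: part_ext => // -[|i]; [lia | have := e i; have := e' i; lia].
Qed.

Lemma rule_hv_fwd_inj kap tau rho nu n nu' n' : is_part nu -> is_part nu' ->
  rule_hv kap tau rho nu n -> rule_hv kap tau rho nu' n' -> nu = nu' /\ n = n'.
Proof.
move=> pn pn' [c c0 e] [c' c0' e'].
(* Comparison from the bottom: beyond the rows of [tau] and [rho] both carries equal the row of
   [kap], and each row passes the equality up. *)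
have ec t : forall i, (size tau + size rho <= i + t)%N -> c i = c' i.
  elim: t => [|t IH] i hi.
    have te : entry tau i = 0%N by rewrite nth_default //; lia.
    have re : entry rho i = 0%N by rewrite nth_default //; lia.
    by have := e i; have := e' i; rewrite te re /=; lia.
  have := IH i.+1; have [_] := e i; have [_] := e' i.
  by case: ifP => _; lia.
have {}ec i : c i = c' i by apply: (ec (size tau + size rho)%N); lia.
split; last by rewrite -c0 -c0' ec.
apply: part_ext => // i; have [_] := e i; have [_] := e' i.
by have := ec i.+1; case: ifP => _; lia.
Qed.

Lemma rule_hv_bwd_inj kap tau rho nu n kap' : is_part kap -> is_part kap' ->
  rule_hv kap tau rho nu n -> rule_hv kap' tau rho nu n -> kap = kap'.
Proof.
move=> pk pk' [c c0 e] [c' c0' e'].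
have ec i : c i = c' i.
  elim: i => [|i IH]; first by rewrite c0.
  by have [_] := e i; have [_] := e' i; case: ifP => _; lia.
apply: part_ext => // i; have [_] := e i; have [_] := e' i.
by have := ec i; case: ifP => _; lia.
Qed.

Lemma cell_fwd_inj p q kap tau rho nu n nu' n' :
  cell p q kap tau rho nu n -> cell p q kap tau rho nu' n' -> nu = nu' /\ n = n'.
Proof.
case: p; case: q => -[_ _ _ pn _ _ _ _ /= ru] [_ _ _ pn' _ _ _ _ /= ru'].
- exact: rule_hh_fwd_inj ru ru'.
- exact: rule_hv_fwd_inj ru ru'.
- exact: rule_hv_fwd_inj ru ru'.
- have [|| e ->] := rule_hh_fwd_inj _ _ _ _ _ _ _ _ _ ru ru'; rewrite ?conj_part //.
  by split=> //; apply: conj_inj.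
Qed.

Lemma cell_bwd_inj p q kap tau rho nu n kap' :
  cell p q kap tau rho nu n -> cell p q kap' tau rho nu n -> kap = kap'.
Proof.
case: p; case: q => -[pk _ _ _ _ _ _ _ /= ru] [pk' _ _ _ _ _ _ _ /= ru'].
- exact: rule_hh_bwd_inj ru ru'.
- exact: rule_hv_bwd_inj ru ru'.
- exact: rule_hv_bwd_inj ru ru'.
- by apply: conj_inj => //; apply: (rule_hh_bwd_inj _ _ _ _ _ _ _ _ ru ru'); apply: conj_part.
Qed.

(** * Box counts across a cell *)

(** Reflection pairs the maximum of row [i.+1] with the minimum of row [i]; the first row of [kap]
    supplies the missing maximum of row 0, and maximum plus minimum of a row is the sum of its two
    entries. *)
Lemma rule_hh_size kap tau rho nu n : rule_hh kap tau rho nu n ->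
  (sumn kap + sumn nu = sumn tau + sumn rho + n)%N.
Proof.
case=> e0 e; pose M := (size kap + size nu + size tau + size rho)%N.
rewrite (sumn_entries kap M.+1) ?(sumn_entries nu M) ?(sumn_entries tau M.+1)
  ?(sumn_entries rho M.+1); try by rewrite /M; lia.
rewrite big_ord_recl -addnA -big_split /=.
under eq_bigr do rewrite e.
have eM f : (\sum_(i < M.+1) entry f i = entry f M + \sum_(i < M) entry f i)%N.
  by rewrite big_ord_recr /= addnC.
have eS f : (\sum_(i < M.+1) entry f i = entry f 0 + \sum_(i < M) entry f i.+1)%N.
  by rewrite big_ord_recl.
have mx : (\sum_(i < M) maxn (entry tau i.+1) (entry rho i.+1) + \sum_(i < M) minn (entry tau i.+1) (entry rho i.+1)
   = \sum_(i < M) entry tau i.+1 + \sum_(i < M) entry rho i.+1)%N.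
  by rewrite -!big_split; apply: eq_bigr => i _ /=; lia.
have mn : (\sum_(i < M) minn (entry tau i) (entry rho i) =
  minn (entry tau 0) (entry rho 0) + \sum_(i < M) minn (entry tau i.+1) (entry rho i.+1))%N.
  rewrite -(big_ord_recl M (fun i => minn (entry tau i) (entry rho i))).
  have n0 : entry tau M = 0%N by rewrite nth_default // /M; lia.
  by rewrite big_ord_recr /= n0 min0n addn0.
rewrite big_split /= e0 !eS mn; move: mx; clear.
by do 4!move: (\sum_(_ < M) _)%N => ?; lia.
Qed.

Lemma rule_hv_size kap tau rho nu n : rule_hv kap tau rho nu n ->
  (sumn kap + sumn nu = sumn tau + sumn rho + n)%N.
Proof.
case=> c c0 e; pose M := (size kap + size nu + size tau + size rho)%N.
(* Over the first [i] rows the balance is off by the carry still in transit. Past all rows this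
   carry equals an entry of [kap] and is zero. *)
have h i : (\sum_(j < i) entry kap j + \sum_(j < i) entry nu j + c i =
    \sum_(j < i) entry tau j + \sum_(j < i) entry rho j + n)%N.
  elim: i => [|i IH]; first by rewrite !big_ord0 c0.
  rewrite !big_ord_recr /=; move: IH; have [_] := e i.
  by do 4!move: (\sum_(_ < i) _)%N => ?; case: ifP => _; lia.
have := h M; rewrite -!sumn_entries; try by rewrite /M; lia.
have [_] := e M; rewrite !nth_default /=; try by rewrite /M; lia.
Qed.

Lemma cell_size p q kap tau rho nu n : cell p q kap tau rho nu n ->
  (sumn kap + sumn nu = sumn tau + sumn rho + n)%N.
Proof.
case: p; case: q => -[pk pt pr pn _ _ _ _ /=].
- exact: rule_hh_size.
- exact: rule_hv_size.
- by move/rule_hv_size; lia.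
- by move/rule_hh_size; rewrite !sumn_conj.
Qed.

Lemma cell_le1 p q kap tau rho nu n : cell p q kap tau rho nu n -> p != q -> (n <= 1)%N.
Proof. by case: p; case: q => -[_ _ _ _ _ _ _ _ //= [c <- /(_ 0%N)[]]]. Qed.

Lemma cell_nil p q : cell p q [::] [::] [::] [::] 0.
Proof.
have hv : rule_hv [::] [::] [::] [::] 0 by exists (fun=> 0%N) => // i; rewrite !nth_nil.
have hh : rule_hh [::] [::] [::] [::] 0 by split=> [|i]; rewrite !nth_nil.
by case: p; case: q; split=> //= i; rewrite ?nth_nil.
Qed.

Lemma strip_nil p b : is_part b -> strip p [::] b -> b = [::].
Proof.
move=> pb h; apply: part_ext => // i; rewrite nth_nil.
by case: p h => /(_ i); rewrite !nth_nil; lia.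
Qed.

(** * Growth diagrams *)

Record growth (px py : nat -> bool) (G : nat -> nat -> seq nat) (n : nat -> nat -> nat)
    (M : nat) : Prop := Growth {
  growth_cell : forall u v,
    cell (px u) (py v) (G u v) (G u.+1 v) (G u v.+1) (G u.+1 v.+1) (n u v);
  growth_nil : forall u v, (M <= u)%N \/ (M <= v)%N -> G u v = [::] }.

(** The diagram is filled outwards from the axes, cell by cell, with [cell_fwd]. *)
Lemma growth_exists_of_boundary px py (A B : nat -> seq nat) M :
  (forall u, is_part (A u)) -> (forall v, is_part (B v)) -> A 0%N = B 0%N ->
  (forall u, strip (px u) (A u) (A u.+1)) -> (forall v, strip (py v) (B v) (B v.+1)) ->
  (forall u, (M <= u)%N -> A u = [::]) -> (forall v, (M <= v)%N -> B v = [::]) ->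
  exists G n, [/\ growth px py G n M, forall u, G u 0%N = A u & forall v, G 0%N v = B v].
Proof.
move=> pA pB AB sA sB zA zB.
(* Choice turns [cell_fwd] into a total function of the two kinds and three corners; its value on
   corners that violate the strip conditions is arbitrary. *)
have fwd (x : bool * bool * (seq nat * seq nat * seq nat)) :
  {y : seq nat * nat | let: (p, q, (kap, tau, rho)) := x in
     is_part kap -> is_part tau -> is_part rho -> strip p kap tau -> strip q kap rho ->
     cell p q kap tau rho y.1 y.2}.
  apply: constructive_indefinite_description; case: x => [[p q] [[kap tau] rho]].
  case: (classic (exists nu n, cell p q kap tau rho nu n)) => [[nu [n h]]|h].
    by exists (nu, n).
  by exists ([::], 0%N) => ? ? ? ? ?; case: h; apply: cell_fwd.
pose F p q kap tau rho := sval (fwd (p, q, (kap, tau, rho))).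
have FP p q kap tau rho : is_part kap -> is_part tau -> is_part rho ->
    strip p kap tau -> strip q kap rho ->
    cell p q kap tau rho (F p q kap tau rho).1 (F p q kap tau rho).2.
  by rewrite /F; case: (fwd _).
pose G := fix g u := if u is u'.+1 then
   fix r v := if v is v'.+1 then (F (px u') (py v') (g u' v') (r v') (g u' v)).1 else A u
   else B.
pose n u v := (F (px u) (py v) (G u v) (G u.+1 v) (G u v.+1)).2.
have G0 u : G u 0%N = A u by case: u.
have row u : (forall v, is_part (G u v) /\ strip (py v) (G u v) (G u v.+1)) ->
    forall v, [/\ is_part (G u.+1 v), strip (px u) (G u v) (G u.+1 v)
    & cell (px u) (py v) (G u v) (G u.+1 v) (G u v.+1) (G u.+1 v.+1) (n u v)].
  move=> hu; have hc v : is_part (G u.+1 v) -> strip (px u) (G u v) (G u.+1 v) ->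
     cell (px u) (py v) (G u v) (G u.+1 v) (G u v.+1) (G u.+1 v.+1) (n u v).
    by move=> h1 h2; apply: FP => //; apply hu.
  elim=> [|v [h1 h2 /[dup] h []]]; last by split=> //; apply: hc.
  by split; [rewrite G0 | rewrite !G0 | apply: hc; rewrite !G0].
have hG u : forall v, is_part (G u v) /\ strip (py v) (G u v) (G u v.+1).
  elim: u => [|u IH] v; first by split; [apply: pB | apply: sB].
  by have [? _ []] := row u IH v.
exists G, n; split=> //; split=> [u v|u v]; first by have [] := row u (hG u) v.
(* An empty shape on an axis empties the whole line through it, because a strip starting at the
   empty shape also ends there. *)
case=> h.
  elim: v => [|v IH]; first by rewrite G0 zA.
  by have [_] := hG u v; rewrite IH => /strip_nil -> //; apply hG.
elim: u => [|u IH]; first by rewrite /= zB.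
by have [h1 h2 _] := row u (hG u) v; rewrite IH in h2; apply: strip_nil h2.
Qed.

(** The diagram is filled inwards with [cell_bwd], starting from the lines at distance [M], where
    all shapes are empty. *)
Lemma growth_exists_of_fill px py (n : nat -> nat -> nat) M :
  (forall u v, (M <= u)%N \/ (M <= v)%N -> n u v = 0%N) ->
  (forall u v, px u != py v -> (n u v <= 1)%N) ->
  exists G, growth px py G n M.
Proof.
move=> n0 n1.
have bwd (x : bool * bool * (seq nat * seq nat * seq nat) * nat) :
  {kap : seq nat | let: (p, q, (tau, rho, nu), m) := x in
     is_part tau -> is_part rho -> is_part nu -> strip q tau nu -> strip p rho nu ->
     (p != q -> m <= 1)%N -> cell p q kap tau rho nu m}.
  apply: constructive_indefinite_description; case: x => [[[p q] [[tau rho] nu]] m].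
  case: (classic (exists kap, cell p q kap tau rho nu m)) => [[kap h]|h].
    by exists kap.
  by exists [::] => ? ? ? ? ? ?; case: h; apply: cell_bwd.
pose F p q tau rho nu m := sval (bwd (p, q, (tau, rho, nu), m)).
have FP p q tau rho nu m : is_part tau -> is_part rho -> is_part nu ->
     strip q tau nu -> strip p rho nu ->
     (p != q -> m <= 1)%N -> cell p q (F p q tau rho nu m) tau rho nu m.
  by rewrite /F; case: (bwd _).
(* Reversed coordinates: [H a b] is the shape at [(M - a, M - b)], so the recursion starts at the
   empty far sides, and step [a] adds the cells with coordinate [X a]. *)
pose X a := (M - a.+1)%N.
pose H := fix h a := if a is a'.+1 then
   fix r b := if b is b'.+1 then
     F (px (X a')) (py (X b')) (h a' b) (r b') (h a' b') (n (X a') (X b')) else [::]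
   else fun=> [::].
have H0 a : H a 0%N = [::] by case: a.
have row a : (forall b, is_part (H a b) /\ strip (py (X b)) (H a b.+1) (H a b)) ->
    forall b, [/\ is_part (H a.+1 b), strip (px (X a)) (H a.+1 b) (H a b)
    & cell (px (X a)) (py (X b)) (H a.+1 b.+1) (H a b.+1) (H a.+1 b) (H a b) (n (X a) (X b))].
  move=> ha; have hc b : is_part (H a.+1 b) -> strip (px (X a)) (H a.+1 b) (H a b) ->
     cell (px (X a)) (py (X b)) (H a.+1 b.+1) (H a b.+1) (H a.+1 b) (H a b) (n (X a) (X b)).
    by move=> h1 h2; apply: FP => //; try apply ha; apply: n1.
  have s0 p : strip p [::] [::] by case: p => i; rewrite !nth_nil.
  elim=> [|b [h1 h2 /[dup] h []]]; last by split=> //; apply: hc.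
  by split; [rewrite H0 | rewrite !H0 | apply: hc; rewrite !H0].
have hH a : forall b, is_part (H a b) /\ strip (py (X b)) (H a b.+1) (H a b).
  elim: a => [|a IH] b; first by split=> //=; case: (py _) => i; rewrite !nth_nil.
  by have [? _ []] := row a IH b.
exists (fun u v => H (M - u)%N (M - v)%N); split=> [u v|u v].
  (* Truncated subtraction sends every corner at or beyond [M] to the empty far side, so the cells
     there are trivial. *)
  case: (leqP M u) => hu.
    have [-> ->] : (M - u = 0 /\ M - u.+1 = 0)%N by lia.
    by rewrite n0; [exact: cell_nil | left].
  case: (leqP M v) => hv.
    have [-> ->] : (M - v = 0 /\ M - v.+1 = 0)%N by lia.
    by rewrite n0 ?H0; [exact: cell_nil | right].
  have [_ _] := row (M - u.+1)%N (hH _) (M - v.+1)%N.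
  have -> : X (M - u.+1)%N = u by rewrite /X; lia.
  have -> : X (M - v.+1)%N = v by rewrite /X; lia.
  by have [-> ->] : ((M - u.+1).+1 = M - u /\ (M - v.+1).+1 = M - v)%N by lia.
case=> h; first by have -> : (M - u = 0)%N by lia.
by have -> : (M - v = 0)%N by lia.
Qed.

Lemma growth_fill_inj px py G n M G' n' M' :
  growth px py G n M -> growth px py G' n' M' ->
  (forall u, G u 0%N = G' u 0%N) -> (forall v, G 0%N v = G' 0%N v) ->
  forall u v, n u v = n' u v.
Proof.
move=> [g _] [g' _] e0 e0'.
have e u : forall v, G u v = G' u v.
  elim: u => [|u IH] //; elim=> [|v IHv] //.
  have := g' u v; rewrite -!IH -IHv => h.
  by have [-> _] := cell_fwd_inj _ _ _ _ _ _ _ _ _ (g u v) h.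
move=> u v; have := g' u v; rewrite -!e => h.
by have [_ ->] := cell_fwd_inj _ _ _ _ _ _ _ _ _ (g u v) h.
Qed.

Lemma growth_boundary_inj px py G n M G' n' M' :
  growth px py G n M -> growth px py G' n' M' ->
  (forall u v, n u v = n' u v) -> forall u v, G u v = G' u v.
Proof.
move=> [g z] [g' z'] en u v.
(* Downward induction on [u], then on [v]: the second [M + M'], generalised to [t], bounds the
   distance to the region where both diagrams are empty. *)
have : (M + M' <= u + (M + M'))%N by lia.
move: {2}(M + M')%N => t; elim: t u v => [|t IH] u v hu.
  by rewrite z ?z' //; left; lia.
have : (M + M' <= v + (M + M'))%N by lia.
move: {2}(M + M')%N => r; elim: r v => [|r IHr] v hv.
  by rewrite z ?z' //; right; lia.
have e1 := IHr v.+1; have e2 w := IH u.+1 w.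
have := g' u v; rewrite -e1 -?e2 -?en; try lia.
move=> h; exact: cell_bwd_inj (g u v) h.
Qed.

Lemma growth_fill0 px py G n M u v :
  growth px py G n M -> (M <= u)%N \/ (M <= v)%N -> n u v = 0%N.
Proof.
move=> [g z] h; have := cell_size _ _ _ _ _ _ _ (g u v).
by rewrite !z /=; lia.
Qed.

(** By [cell_size] the difference between neighbouring sizes changes by [n] at each cell; it is
    telescoped first along [v], then along [u]. *)
Lemma growth_size px py G n M u v : growth px py G n M ->
  sumn (G u v) = (\sum_(u <= i < M) \sum_(v <= j < M) n i j)%N.
Proof.
move=> gr; have [g z] := gr.
have row w : sumn (G w v) = (sumn (G w.+1 v) + \sum_(v <= j < M) n w j)%N.
  have : (M <= v + M)%N by lia.
  move: {2}M => t; elim: t v => [|t IH] x hx.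
    by rewrite big_geq ?z //; lia.
  case: (leqP M x) => h; first by rewrite big_geq // !z //; lia.
  rewrite big_ltn //; have := IH x.+1; have := cell_size _ _ _ _ _ _ _ (g w x).
  by lia.
have : (M <= u + M)%N by lia.
move: {2}M => t; elim: t u => [|t IH] x hx.
  by rewrite big_geq ?z //; lia.
case: (leqP M x) => h; first by rewrite big_geq // !z //; lia.
rewrite big_ltn // row IH; last by lia.
by rewrite addnC.
Qed.

(** * Plane partitions as boundaries *)

Lemma leq_by_lt x y : (forall i, i < x -> i < y)%N -> (x <= y)%N.
Proof. by move=> h; rewrite leqNgt; apply/negP => /h; rewrite ltnn. Qed.

Lemma eq_by_lt x y : (forall i, (i < x) = (i < y))%N -> x = y.
Proof. by move=> h; apply/eqP; rewrite eqn_leq !leq_by_lt // => i; rewrite h. Qed.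

(** Two views of one three-dimensional diagram of boxes [(j, i, u)]: its slices [X u] and its
    heights [x j i]. *)
Definition galois (X : nat -> seq nat) (x : nat -> nat -> nat) :=
  forall u j i, (i < entry (X u) j)%N = (u < x j i)%N.

(* Equality of neighbours at the value u.+1 is allowed along rows of the tableau only
   if p u, and down its columns only if ~~ p u. *)
Definition ties (p : nat -> bool) (x : nat -> nat -> nat) :=
  forall j i u, x j i = u.+1 ->
    (x j i.+1 = u.+1 -> p u) /\ (x j.+1 i = u.+1 -> ~~ p u).

(** The boxes of [X u] outside [X u.+1] are the positions with [x j i = u.+1]. A horizontal strip
    has no two of them in one column [i], a vertical strip no two in one row [j], and monotonicity
    of [x] reduces this to neighbours. *)
Lemma strips_ties (X : nat -> seq nat) x p : galois X x -> (forall u, is_part (X u)) ->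
  (forall u, strip (p u) (X u) (X u.+1)) <-> ties p x.
Proof.
move=> gal pX.
have xj j i : (x j.+1 i <= x j i)%N.
  by apply: leq_by_lt => u; rewrite -!gal => /leq_trans; apply; apply: part_dec.
have xi j i : (x j i.+1 <= x j i)%N.
  by apply: leq_by_lt => u; rewrite -!gal => /ltnW.
split=> [h j i u e|h u].
  split=> e'.
    apply: contraT => pu; have := h u; rewrite (negbTE pu) => /(_ j) /andP[_].
    have := gal u j i.+1; have := gal u.+1 j i; rewrite e e'; lia.
  apply/negP => pu; have := h u; rewrite pu => /(_ j) /andP[].
  have := gal u j.+1 i; have := gal u.+1 j i; rewrite e e'; lia.
have mono j : (entry (X u.+1) j <= entry (X u) j)%N.
  by apply: leq_by_lt => i; rewrite !gal => /ltnW.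
case pu : (p u) => j; rewrite mono ?andbT /=.
  apply: leq_by_lt => i; rewrite !gal => hu; have := xj j i.
  case: (ltnP u.+1 (x j i)) => // h1 h2.
  have [e e'] : x j i = u.+1 /\ x j.+1 i = u.+1 by lia.
  by have [_ /(_ e')] := h j i u e; rewrite pu.
set i := entry (X u.+1) j; rewrite leqNgt; apply/negP; rewrite gal => h1.
have h2 := gal u.+1 j i; rewrite ltnn in h2; have h3 := xi j i.
have [e e'] : x j i = u.+1 /\ x j i.+1 = u.+1 by lia.
by have [/(_ e')] := h j i u e; rewrite pu.
Qed.

Section Boundary.
Variables (s : int -> bool) (k : int).

(** [px u] governs the value [u.+1] of lambda, whereas [py v] governs the value [v] of mu: the
    sequence [B] is shifted by one because [B 0] repeats [A 0]. In particular [py 0] holds. *)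
Definition px (u : nat) := s (k + u.+1%:Z)%R == s k.
Definition py (v : nat) := s (k - v%:Z)%R == s k.
Definition lamP (P : plane) j i := entry (nth zpair P j).1 i.
Definition muP (P : plane) j i := entry (nth zpair P j).2 i.

(** [in_P] controls equal neighbours within one term and [ge_k] those in consecutive terms; together
    they give [ties]. The comparisons of sizes and of zero entries become the chain of supports in
    the last clause. *)
Lemma is_PP_ties P : is_PP s k P <->
  [/\ forall p, p \in P -> p != zpair,
      forall j, is_part (nth zpair P j).1 /\ is_part (nth zpair P j).2,
      forall j i, (lamP P j.+1 i <= lamP P j i)%N /\ (muP P j.+1 i <= muP P j i)%N,
      ties px (lamP P) /\ ties (fun v => py v.+1) (muP P)
    & forall j i, (0 < lamP P j.+1 i -> 0 < muP P j i)%N /\ (0 < muP P j i -> 0 < lamP P j i)%N].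
Proof.
rewrite /lamP /muP; split.
  case=> nz inP ge; split=> // [j|j i||j i]; first by have [] := inP j.
  - have := ge j; case: (nth zpair P j) => l1 m1; case: (nth zpair P j.+1) => l2 m2.
    case=> _ _ _ hl hm; split.
      by case: (ltnP i (size l2)) => hi; [have [] := hl i hi | rewrite (nth_default _ hi)].
    by case: (ltnP i (size m2)) => hi; [have [] := hm i hi | rewrite (nth_default _ hi)].
  - split=> j i u e; split=> e'.
    + have [_ _ _ h _] := inP j; have [|e0|[]] := h i; rewrite ?e //.
      by rewrite /px -e e0.
    + have [p1 _ _ _ _] := inP j.+1; move: (ge j) e e' p1.
      case: (nth zpair P j) => l1 m1; case: (nth zpair P j.+1) => l2 m2 /=.
      case=> _ _ _ hl _ e e' p1.
      have hi : (i < size l2)%N by rewrite -(entry_gt0 l2 i p1) e'.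
      have [_ /(_ (etrans e (esym e')))] := hl i hi; rewrite e => -[] // e0.
      by rewrite /px GRing.addrC e0; case: (s k).
    + have [_ _ _ _ h] := inP j; have [|e0|[]] := h i; rewrite ?e //.
      by rewrite /py -e e0.
    + have [_ p1 _ _ _] := inP j.+1; move: (ge j) e e' p1.
      case: (nth zpair P j) => l1 m1; case: (nth zpair P j.+1) => l2 m2 /=.
      case=> _ _ _ _ hl e e' p1.
      have hi : (i < size m2)%N by rewrite -(entry_gt0 m2 i p1) e'.
      have [_ /(_ (etrans e (esym e')))] := hl i hi; rewrite e => -[] // e0.
      by rewrite /py e0; case: (s k).
  have [p1 p2 h0 _ _] := inP j; have [p3 p4 _ _ _] := inP j.+1; split; last first.
    by have := h0 i; lia.
  move: (ge j) p1 p2 p3 p4; case: (nth zpair P j) => l1 m1; case: (nth zpair P j.+1) => l2 m2 /=.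
  by case=> h _ _ _ _ p1 p2 p3 p4; rewrite !entry_gt0 // => /leq_trans; apply.
case=> nz pp dec [tl tm] supp.
have le_size a b : is_part a -> is_part b -> (forall i, 0 < entry a i -> 0 < entry b i)%N ->
    (size a <= size b)%N.
  by move=> pa pb h; apply: leq_by_lt => i; rewrite -!entry_gt0 //; apply: h.
split=> // j.
  have [p1 p2] := pp j; split=> // i.
  - by have [_] := supp j i; lia.
  - move=> e; case E: (entry (nth zpair P j).1 i) => [|u]; first by left; rewrite GRing.addr0.
    by have [h _] := tl j i u E; left; apply/eqP/h; rewrite -e.
  - move=> e; case E: (entry (nth zpair P j).2 i) => [|u]; first by left; rewrite GRing.subr0.
    by have [h _] := tm j i u E; left; apply/eqP/h; rewrite -e.
have [p1 p2] := pp j; have [p3 p4] := pp j.+1.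
move: (supp j) (dec j) (tl j) (tm j) p1 p2 p3 p4; rewrite /lamP /muP.
case: (nth zpair P j) => l1 m1; case: (nth zpair P j.+1) => l2 m2 /= {}supp {}dec {}tl {}tm p1 p2 p3 p4.
split=> [|||i hi|i hi]; try by apply: le_size => // i; have [] := supp i; have [] := dec i; lia.
  have [? _] := dec i; split=> // e.
  case E: (entry l1 i) => [|u]; first by right.
  have [_ h] := tl i u E; left; have := h (etrans (esym e) E).
  by rewrite /px GRing.addrC; case: (s k); case: (s _).
have [_ ?] := dec i; split=> // e.
case E: (entry m1 i) => [|u]; first by right.
have [_ h] := tm i u E; left; have := h (etrans (esym e) E).
by rewrite /py; case: (s k); case: (s _).
Qed.

Record boundary (A B : nat -> seq nat) (M : nat) : Prop := Boundary {
  bd_partA : forall u, is_part (A u);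
  bd_partB : forall v, is_part (B v);
  bd_0 : A 0%N = B 0%N;
  bd_stripA : forall u, strip (px u) (A u) (A u.+1);
  bd_stripB : forall v, strip (py v) (B v) (B v.+1);
  bd_nilA : forall u, (M <= u)%N -> A u = [::];
  bd_nilB : forall v, (M <= v)%N -> B v = [::] }.

Definition bounds P (A B : nat -> seq nat) :=
  galois A (lamP P) /\ galois (fun v => B v.+1) (muP P).

Lemma part_nil l : is_part l -> entry l 0 = 0%N -> l = [::].
Proof. by case: l => // x l; rewrite is_part_cons => /and3P[h _ _] /= e; rewrite e in h. Qed.

Lemma galois_exists (X : nat -> seq nat) (m : nat) :
  (forall j, is_part (X j)) -> (forall j i, entry (X j.+1) i <= entry (X j) i)%N ->
  X m = [::] ->
  exists Y, galois Y (fun j i => entry (X j) i) /\ forall u, is_part (Y u).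
Proof.
move=> pX dec Xm.
have h u : exists l, is_part l /\ forall j i, (i < entry l j)%N = (u < entry (X j) i)%N.
  have [||l pl e] := @part_of_fun (fun j => count (ltn u) (X j)) m.
  - by move=> j; apply: leq_by_lt => i; rewrite !lt_conj // => /leq_trans; apply.
  - by rewrite Xm.
  by exists l; split=> // j i; rewrite e lt_conj.
exists (fun u => sval (constructive_indefinite_description _ (h u))).
by split=> [u j i|u]; case: (constructive_indefinite_description _ _) => l [].
Qed.

(** The inverse of slicing: for fixed [j] the row lengths of the slices decrease in [u], and the
    conjugate of this sequence lists the heights. *)
Lemma galois_inv (X : nat -> seq nat) (m : nat) :
  (forall u i, entry (X u.+1) i <= entry (X u) i)%N -> X m = [::] ->
  exists Y, galois X (fun j i => entry (Y j) i) /\ forall j, is_part (Y j).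
Proof.
move=> dec Xm.
have h j : exists l, is_part l /\ forall u i, (i < entry (X u) j)%N = (u < entry l i)%N.
  have [||l pl e] := @part_of_fun (fun u => entry (X u) j) m => //.
    by rewrite Xm nth_nil.
  by exists (conjp l); split=> [|u i]; rewrite ?conj_part // conjP // e.
exists (fun u => sval (constructive_indefinite_description _ (h u))).
by split=> [u j i|u]; case: (constructive_indefinite_description _ _) => l [].
Qed.

Lemma boundary_of_plane P : is_PP s k P -> exists A B M, boundary A B M /\ bounds P A B.
Proof.
move/is_PP_ties => [nz pp dec [tl tm] supp].
have [||| A [gA pA]] := galois_exists (fun j => (nth zpair P j).1) (size P).
- by move=> j; have [] := pp j.
- by move=> j i; have [] := dec j i.
- by rewrite nth_default.
have [||| B [gB pB]] := galois_exists (fun j => (nth zpair P j).2) (size P).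
- by move=> j; have [] := pp j.
- by move=> j i; have [] := dec j i.
- by rewrite nth_default.
(* No entry exceeds [lamP P 0 0] or [muP P 0 0] respectively, so the slices are empty from there on;
   the successor absorbs the shift of [B]. *)
exists A, (fun v => if v is v'.+1 then B v' else A 0%N), (lamP P 0 0 + muP P 0 0).+1.
split; last by split.
split=> //.
- by case.
- exact: (proj2 (strips_ties A (lamP P) px gA pA)).
(* The strip from [B 0] to [B 1] is horizontal and expresses the chain of supports of
   [is_PP_ties]. *)
- case=> [|v]; last exact: (proj2 (strips_ties B (muP P) (fun v => py v.+1) gB pB)).
  rewrite /py GRing.subr0 eqxx => j; apply/andP; split; apply: leq_by_lt => i; rewrite gA gB;
    by have [] := supp j i.
- by move=> u hu; apply: part_nil => //; apply/eqP; rewrite -leqn0 leqNgt gA; rewrite /lamP in hu; lia.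
- case=> // v hv; apply: part_nil => //; apply/eqP; rewrite -leqn0 leqNgt gB; rewrite /muP in hv; lia.
Qed.

Lemma plane_of_boundary A B M : boundary A B M -> exists P, is_PP s k P /\ bounds P A B.
Proof.
case=> pA pB AB sA sB nA nB.
have le_strip p a b i : strip p a b -> (entry b i <= entry a i)%N.
  by case: p => /(_ i); lia.
have [|| L [gL pL]] := galois_inv A M.
- by move=> u i; apply: le_strip (sA u).
- exact: nA.
have [|| U [gU pU]] := galois_inv (fun v => B v.+1) M.
- by move=> u i; apply: le_strip (sB u.+1).
- by apply: nB; lia.
(* The rows of [A 0] count the nonzero entries of each lambda, so beyond [size (A 0)] every lambda
   vanishes, and mu with it. *)
pose P := mkseq (fun j => (L j, U j)) (size (A 0%N)).
have entry0 j : (size (A 0%N) <= j)%N -> forall u, entry (A u) j = 0%N.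
  move=> hj; elim=> [|u IH]; first by rewrite nth_default.
  by have := le_strip _ _ _ j (sA u); lia.
have supp j i : (0 < entry (L j.+1) i -> 0 < entry (U j) i)%N /\
                (0 < entry (U j) i -> 0 < entry (L j) i)%N.
  have := sB 0%N; rewrite /py GRing.subr0 eqxx => /(_ j); have := gL 0%N j.+1 i; have := gU 0%N j i; have := gL 0%N j i; rewrite -AB; lia.
have nthP j : nth zpair P j = (L j, U j).
  case: (ltnP j (size (A 0%N))) => hj; first by rewrite nth_mkseq.
  rewrite nth_default ?size_mkseq //.
  have l0 : L j = [::] by apply: part_nil => //; apply: eq_by_lt => u; rewrite -gL entry0.
  have [_] := supp j 0%N; rewrite l0 => h.
  by rewrite (part_nil (U j)) //=; move: h; case: (entry _ _) => // ? /(_ isT).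
have bP : bounds P A B.
  by split=> u j i; rewrite /lamP /muP nthP ?gL ?(gU u).
exists P; split=> //; case: bP => gA gB; apply/is_PP_ties; split.
- move=> p /mapP[j]; rewrite mem_iota => /andP[_ hj] -> ; apply/eqP => -[l0 _].
  by have := gL 0%N j 0%N; rewrite l0 entry_gt0 // hj.
- by move=> j; rewrite nthP /=.
- by move=> j i; split; apply: leq_by_lt => u; [rewrite -!gA | rewrite -!(gB u)] => /leq_trans;
    apply; apply: part_dec.
- split; first exact: (proj1 (strips_ties A (lamP P) px gA pA) sA).
  by apply: (proj1 (strips_ties (fun v => B v.+1) (muP P) (fun v => py v.+1) gB _)).
- by move=> j i; rewrite /lamP /muP !nthP; apply: supp.
Qed.

Lemma bounds_inj P P' A B : is_PP s k P -> is_PP s k P' ->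
  bounds P A B -> bounds P' A B -> P = P'.
Proof.
move=> /is_PP_ties[nz pp _ _ _] /is_PP_ties[nz' pp' _ _ _] [gA gB] [gA' gB'].
have e j : nth zpair P j = nth zpair P' j.
  have [p1 p2] := pp j; have [p3 p4] := pp' j.
  rewrite [LHS]surjective_pairing [RHS]surjective_pairing; congr pair.
    by apply: part_ext => // i; apply: eq_by_lt => u; rewrite -[LHS]gA -[RHS]gA'.
  by apply: part_ext => // i; apply: eq_by_lt => u; rewrite -[LHS]gB -[RHS]gB'.
(* With no zero terms, the length of a list can be read off from [nth]. *)
have ltsz Q j : (forall p, p \in Q -> p != zpair) -> (j < size Q)%N = (nth zpair Q j != zpair).
  move=> h; case: ltnP => hj; first by rewrite h // mem_nth.
  by rewrite nth_default ?eqxx.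
apply: (@eq_from_nth _ zpair) => [|j _]; last exact: e.
by apply: eq_by_lt => j; rewrite !ltsz // e.
Qed.

End Boundary.

(** * Coefficients of the product *)

Lemma mleP N (a d : mon N) : reflect (forall i, a i <= d i)%N (mle N a d).
Proof. exact: forallP. Qed.

Lemma mdeg_le N (a d : mon N) : mle N a d -> (mdeg N a <= mdeg N d)%N.
Proof. by move/mleP => h; apply: leq_sum. Qed.

Lemma mon_le_mdeg N (a : mon N) i : (a i <= mdeg N a)%N.
Proof. by rewrite /mdeg (bigD1 i) //= leq_addr. Qed.

Lemma mem_below N (a d : mon N) : (a \in below N d) = mle N a d.
Proof.
rewrite mem_filter; case: (boolP (mle N a d)) => // h; apply/mapP.
exists [ffun i => inord (a i)]; first by rewrite mem_enum.
apply/ffunP => i; rewrite !ffunE inordK // ltnS.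
exact: leq_trans (mon_le_mdeg _ a i) (mdeg_le _ _ _ h).
Qed.

Lemma below_uniq N (d : mon N) : uniq (below N d).
Proof.
rewrite filter_uniq // map_inj_uniq ?enum_uniq // => f g /ffunP e.
by apply/ffunP => i; apply: val_inj; have := e i; rewrite !ffunE.
Qed.

Lemma mscale_inj N (e : mon N) r r' : e <> mzero N -> mscale N r e = mscale N r' e -> r = r'.
Proof.
move=> e0 /ffunP h; case: (pickP (fun i => e i != 0%N)) => [i hi|hz].
  by have := h i; rewrite !ffunE => /eqP; rewrite eqn_mul2r (negbTE hi) => /eqP.
by case: e0; apply/ffunP => i; rewrite ffunE; apply/eqP; have := hz i => /negbFE.
Qed.

Lemma leq_mdeg_mscale N (e : mon N) r : e <> mzero N -> (r <= mdeg N (mscale N r e))%N.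
Proof.
move=> e0; case: (pickP (fun i => e i != 0%N)) => [i hi|hz].
  by apply: leq_trans (mon_le_mdeg _ _ i); rewrite ffunE leq_pmulr // lt0n.
by case: e0; apply/ffunP => i; rewrite ffunE; apply/eqP; have := hz i => /negbFE.
Qed.

Lemma mscale0 N (e : mon N) : mscale N 0 e = mzero N.
Proof. by apply/ffunP => i; rewrite !ffunE. Qed.

Lemma mscale1 N (e : mon N) : mscale N 1 e = e.
Proof. by apply/ffunP => i; rewrite !ffunE mul1n. Qed.

(** * Coefficients as numbers of exponent lists *)

Section Solutions.
Variables (N : nat) (T : eqType) (e : T -> mon N) (sg : T -> bool).
Hypothesis e_neq0 : forall x, e x <> mzero N.

Definition geom (x : T) : fps N := fun d =>
  (if sg x then ([exists r : 'I_(mdeg N d).+1, d == mscale N (r : nat) (e x)] : nat)%:Z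
  else (((d == mzero N) || (d == e x)) : nat)%:Z)%R.

Definition admissible x r := sg x || (r <= 1)%N.

Definition exponents x (d : mon N) :=
  [seq r <- iota 0 (mdeg N d).+1 | admissible x r && mle N (mscale N r (e x)) d].

Fixpoint solutions (xs : seq T) (d : mon N) : seq (seq nat) :=
  if xs is x :: xs' then
    [seq r :: c | r <- exponents x d, c <- solutions xs' (msub N d (mscale N r (e x)))]
  else if d == mzero N then [:: [::]] else [::].

(** At most one [r] contributes, since [e x] is nonzero. The range of [r] depends on [d] rather than
    on [a], so that the sums over [a] and [r] can be exchanged in [size_solutions]. *)
Lemma geomE x d a : mle N a d ->
  geom x a = (\sum_(r <- iota 0 (mdeg N d).+1 | admissible x r && mle N (mscale N r (e x)) d)
     (a == mscale N r (e x) : nat)%:Z)%R.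
Proof.
move=> ad.
have none : (forall r, admissible x r -> a <> mscale N r (e x)) -> 
  (\sum_(r <- iota 0 (mdeg N d).+1 | admissible x r && mle N (mscale N r (e x)) d)
     (a == mscale N r (e x) : nat)%:Z)%R = 0%R.
  by move=> h; rewrite big1 // => r /andP[/h/eqP/negbTE -> _].
have one r : admissible x r -> a = mscale N r (e x) ->
  (\sum_(r <- iota 0 (mdeg N d).+1 | admissible x r && mle N (mscale N r (e x)) d)
     (a == mscale N r (e x) : nat)%:Z)%R = 1%R.
  move=> h ea; rewrite big_mkcond (bigD1_seq r) ?iota_uniq //; last first.
    rewrite mem_iota /= add0n ltnS; apply: leq_trans (mdeg_le _ _ _ ad).
    by rewrite ea leq_mdeg_mscale.
  rewrite /= h -ea ad eqxx /= big1 ?GRing.addr0 // => r' /eqP hr.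
  case: ifP => // _; case: eqP => // ea'; case: hr.
  by apply: (mscale_inj _ (e x)) => //; rewrite -ea.
rewrite /geom; case sx: (sg x).
  case: existsP => [[r /eqP er]|h]; first by rewrite (one r) // /admissible sx.
  rewrite none // => r _ er; apply: h.
  have hr : (r < (mdeg N a).+1)%N by rewrite ltnS er leq_mdeg_mscale.
  by exists (Ordinal hr); rewrite -er.
case: eqP => [a0|h0] /=.
  by rewrite (one 0%N) ?mscale0 // /admissible orbT.
case: eqP => [a1|h1] /=.
  by rewrite (one 1%N) ?mscale1 // /admissible orbT.
rewrite none // => r; rewrite /admissible sx /=.
by case: r => [|[|]] // _; rewrite ?mscale0 ?mscale1.
Qed.

Lemma size_solutions xs d :
  fps_prod N [seq geom x | x <- xs] d = (size (solutions xs d))%:Z%R.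
Proof.
elim: xs d => [|x xs IH] d /=; first by rewrite /fps_prod /= /fps_one; case: eqP.
rewrite size_allpairs_dep sumnE big_map /exponents big_filter.
transitivity (\sum_(r <- iota 0 (mdeg N d).+1 | admissible x r && mle N (mscale N r (e x)) d)
   (size (solutions xs (msub N d (mscale N r (e x)))))%:Z)%R; last first.
  by rewrite -(big_morph Posz PoszD (erefl (Posz 0))).
rewrite /fps_prod /= /fps_mul big_seq.
under eq_bigr => a ha.
  rewrite (geomE x d a); last by rewrite -mem_below.
  rewrite GRing.mulr_suml; over.
(* For fixed [r] only [a = mscale N r (e x)] survives. *)
rewrite -big_seq exchange_big /=; apply: eq_bigr => r /andP[_ hr].
rewrite (bigD1_seq (mscale N r (e x))) ?below_uniq ?mem_below //= eqxx GRing.mul1r.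
rewrite big1 ?GRing.addr0; first exact: IH.
by move=> a /negbTE ->; rewrite GRing.mul0r.
Qed.

Lemma solutions_uniq xs d : uniq (solutions xs d).
Proof.
elim: xs d => [|x xs IH] d /=; first by case: eqP.
apply: allpairs_uniq_dep => [|r _|]; first by rewrite /exponents filter_uniq // iota_uniq.
  exact: IH.
by move=> [r c] [r' c'] _ _ /= [-> ->].
Qed.

Lemma mem_solutions x0 xs d c : c \in solutions xs d <->
  [/\ size c = size xs,
      forall i, (i < size xs)%N -> admissible (nth x0 xs i) (nth 0%N c i)
    & forall t, d t = (\sum_(i < size xs) nth 0 c i * e (nth x0 xs i) t)%N].
Proof.
elim: xs d c => [|x xs IH] d c /=.
  case: eqP => hd; last first.
    by split=> // -[_ _ h]; case: hd; apply/ffunP => t; rewrite ffunE h big_ord0.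
  rewrite inE; split=> [/eqP ->|[/size0nil -> _ _]] //.
  by split=> // t; rewrite big_ord0 hd ffunE.
split.
  case/allpairsPdep => r [c' []]; rewrite /exponents mem_filter => /andP[/andP[ar lr] _] /IH[sc ac wc] ->.
  split=> [|[|i] //|t]; rewrite /= ?sc //; first by move=> hi; apply: ac.
  rewrite big_ord_recl /= -wc ffunE ffunE; have /mleP/(_ t) := lr; rewrite ffunE; lia.
case: c => [[] //|r c] [[sc] ac wc]; apply/allpairsPdep; exists r, c.
have lr : mle N (mscale N r (e x)) d.
  by apply/mleP => t; rewrite wc big_ord_recl /= ffunE leq_addr.
split=> //.
  rewrite /exponents mem_filter lr (ac 0%N) // mem_iota /= add0n ltnS.
  exact: leq_trans (leq_mdeg_mscale _ _ _ (e_neq0 x)) (mdeg_le _ _ _ lr).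
apply/IH; split=> // [i hi|t]; first exact: (ac i.+1).
by rewrite !ffunE wc big_ord_recl /= addKn.
Qed.

End Solutions.

(** * Weights *)

(** The product of the [s_t s_(t+1)] telescopes to the two ends. *)
Lemma odd_bar_count s i n :
  odd (count (fun u : nat => bar s (i + u%:Z)%R) (iota 0 n)) = (s i != s (i + n%:Z)%R).
Proof.
elim: n => [|n IH]; first by rewrite GRing.addr0 eqxx.
rewrite -addn1 iotaD count_cat oddD IH /= addn0 add0n /bar.
have -> : (i + n%:Z + 1 = i + (n + 1)%N%:Z)%R by lia.
by rewrite oddb; case: (s i); case: (s _); case: (s _).
Qed.

Lemma sigma_eq1 s (i : int) n :
  (sigma s i (i + n%:Z)%R == 1%R) = (s i == s (i + n.+1%:Z)%R).
Proof.
rewrite /sigma; have -> : absz (i + n%:Z - i)%R = n by lia.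
by rewrite -GRing.signr_odd odd_bar_count; case: (s i == _).
Qed.

(** Both kinds are measured against [s k], so comparing them compares the ends [k - a] and
    [k + b + 1] of the telescoped sign. Thus the factor is [1 + z] exactly at the cells of mixed
    kind, where the local rule has [n <= 1]. *)
Lemma sigma_px_py s k a b :
  (sigma s (k - a%:Z)%R (k + b%:Z)%R == 1%R) = (px s k b == py s k a).
Proof.
have -> : (k + b%:Z = k - a%:Z + (a + b)%N%:Z)%R by lia.
rewrite sigma_eq1 /px /py.
have -> : (k - a%:Z + (a + b).+1%:Z = k + b.+1%:Z)%R by lia.
by case: (s k); case: (s _); case: (s _).
Qed.

Lemma count_iota0 (f : nat -> bool) n : count f (iota 0 n) = (\sum_(w < n) f w)%N.
Proof. by rewrite -sumn_count sumnE big_map -{1}[n]subn0 -/(index_iota 0 n) big_mkord. Qed.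

Lemma sum_ord_widen (f : nat -> nat) n M : (n <= M)%N ->
  (\sum_(w < n) f w = \sum_(w < M) (w < n) * f w)%N.
Proof.
move=> h; rewrite (big_ord_widen _ _ h) big_mkcond; apply: eq_bigr => w _.
by case: (w < n)%N; rewrite ?mul1n.
Qed.

Section Weight.
Variables (N : nat) (s : int -> bool) (k : int).
Hypothesis N_gt0 : (0 < N)%N.

(** The interval is cut at [k] because the boxes of slice [A w] have colour [k + w] and those of
    [B w.+1] colour [k - w.+1]. *)
Lemma zmonE a b (t : 'I_N) : zmon N (k - a%:Z)%R (k + b%:Z)%R t =
  (\sum_(w < b.+1) color_eq N (k + (w : nat)%:Z)%R t +
   \sum_(w < a) color_eq N (k - w.+1%:Z)%R t)%N.
Proof.
rewrite ffunE; have -> : (absz (k + b%:Z - (k - a%:Z))%R).+1 = (a + b.+1)%N by lia.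
rewrite iotaD count_cat addnC; congr (_ + _)%N.
  rewrite add0n -[X in iota X]addn0 iotaDl count_map count_iota0; apply: eq_bigr => w _ /=.
  by congr (nat_of_bool (color_eq _ _ _)); lia.
rewrite count_iota0 [RHS](reindex_inj rev_ord_inj); apply: eq_bigr => w _ /=.
by congr (nat_of_bool (color_eq _ _ _)); have := ltn_ord w; lia.
Qed.

Lemma color_sum (x : int) : (\sum_(t < N) color_eq N x t = 1)%N.
Proof.
have h : (0 <= (x %% N%:Z)%Z < N%:Z)%R by rewrite modz_ge0 ?ltz_pmod //; lia.
have ht : (absz (x %% N%:Z)%Z < N)%N by lia.
rewrite (bigD1 (Ordinal ht)) //= big1.
  by rewrite /color_eq /=; case: eqP => //; lia.
move=> t /eqP ht'; rewrite /color_eq; case: eqP => // e; case: ht'.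
by apply: val_inj => /=; rewrite e.
Qed.

Lemma mdeg_zmon a b : mdeg N (zmon N (k - a%:Z)%R (k + b%:Z)%R) = (a + b).+1.
Proof.
have h (f : nat -> int) m : (\sum_(t < N) \sum_(w < m) color_eq N (f w) t = m)%N.
  rewrite exchange_big /=; under eq_bigr do rewrite color_sum.
  by rewrite sum1_card card_ord.
rewrite /mdeg; under eq_bigr do rewrite zmonE; rewrite big_split /=.
by rewrite (h (fun w => k + w%:Z)%R) (h (fun w => k - w.+1%:Z)%R); lia.
Qed.

Lemma zmon_neq0 a b : zmon N (k - a%:Z)%R (k + b%:Z)%R <> mzero N.
Proof.
move=> e; have := mdeg_zmon a b; rewrite e /mdeg big1 // => t _.
by rewrite ffunE.
Qed.

Lemma wtPPE (P : plane) t : wtPP N k P t = (\sum_(p <- P) wt N k p.1 p.2 t)%N.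
Proof.
elim: P => [|p P IH]; first by rewrite big_nil ffunE.
by rewrite big_cons -IH /= ffunE.
Qed.

Lemma sum_rows (f : nat -> nat) l M : (forall x, x \in l -> x <= M)%N ->
  (\sum_(x <- l) \sum_(w < x) f w = \sum_(w < M) count (ltn w) l * f w)%N.
Proof.
elim: l => [|x l IH] h; first by rewrite big_nil big1.
rewrite big_cons IH => [|y hy]; last by apply: h; rewrite inE hy orbT.
rewrite (sum_ord_widen f x M) ?h ?mem_head // -big_split.
by apply: eq_bigr => w _; rewrite /= -mulnDl.
Qed.

(** The correspondence between plane partitions and arrays, kept as a relation; existence and
    uniqueness are proved separately in each direction. *)
Definition fills P (n : nat -> nat -> nat) :=
  exists A B G M, [/\ bounds P A B, growth (px s k) (py s k) G n M,
    forall u, G u 0%N = A u & forall v, G 0%N v = B v].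

Lemma sumn_galois (P : plane) X (f : seq nat * seq nat -> seq nat) :
  f zpair = [::] -> (forall j, is_part (f (nth zpair P j))) ->
  galois X (fun j i => entry (f (nth zpair P j)) i) -> forall u, is_part (X u) ->
  sumn (X u) = (\sum_(p <- P) count (ltn u) (f p))%N.
Proof.
move=> f0 pf g u pX; rewrite (sumn_entries _ (size P)); last first.
  apply: leq_by_lt => j; rewrite -entry_gt0 // g; case: (ltnP j (size P)) => // hj.
  by rewrite (nth_default zpair hj) f0.
rewrite (big_nth zpair) big_mkord; apply: eq_bigr => j _.
by apply: eq_by_lt => i; rewrite g lt_conj.
Qed.

Lemma fills_weight P n : is_PP s k P -> fills P n ->
  exists M, (forall u v, (M <= u)%N \/ (M <= v)%N -> n u v = 0%N) /\
   forall t, wtPP N k P t =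
    (\sum_(u < M) \sum_(v < M) n u v * zmon N (k - (v : nat)%:Z)%R (k + (u : nat)%:Z)%R t)%N.
Proof.
move=> /is_PP_ties[_ pp _ _ _] [A [B [G [M [[gA gB] gr GA GB]]]]]; have [cl nl] := gr.
exists M; split=> [u v|t]; first exact: growth_fill0 gr.
have pA u : is_part (A u) by rewrite -GA; case: (cl u 0%N).
have pB v : is_part (B v) by rewrite -GB; case: (cl 0%N v).
have leM X (f : seq nat * seq nat -> seq nat) : f zpair = [::] ->
    galois X (fun j i => entry (f (nth zpair P j)) i) ->
    (forall u, (M <= u)%N -> X u = [::]) -> forall p, p \in P -> forall x, x \in f p -> (x <= M)%N.
  move=> f0 g XM p /(nthP zpair)[j _ <-] x /(nthP 0%N)[i _ <-].
  apply: leq_by_lt => u; rewrite -g; case: (ltnP u M) => // hu.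
  by rewrite XM // nth_nil.
pose cp w : nat := color_eq N (k + w%:Z)%R t; pose cm w : nat := color_eq N (k - w.+1%:Z)%R t.
(* All boxes of a slice share one colour, so the weight depends only on the sizes of the slices
   along the two axes. *)
have -> : wtPP N k P t = (\sum_(w < M) cp w * sumn (G w 0%N) + \sum_(w < M) cm w * sumn (G 0%N w.+1))%N.
  rewrite wtPPE big_seq.
  under eq_bigr => p hp.
    rewrite ffunE.
    under eq_bigr do rewrite count_iota0.
    under [X in (_ + X)%N]eq_bigr => x _.
      rewrite -{1}[1%N]addn0 iotaDl count_map count_iota0.
      over.
    rewrite (sum_rows cp p.1 M); last first.
      by apply: (leM A fst) hp => // u hu; rewrite -GA nl //; left.
    rewrite (sum_rows cm p.2 M); last first.
      by apply: (leM (fun v => B v.+1) snd) hp => // u hu; rewrite -GB nl //; right; lia.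
    over.
  rewrite -big_seq big_split /= exchange_big [X in (_ + X)%N]exchange_big /=.
  congr (_ + _)%N; apply: eq_bigr => w _; rewrite -big_distrl mulnC /=.
    rewrite GA (sumn_galois P A fst) // => j; by have [] := pp j.
  rewrite GB (sumn_galois P (fun v => B v.+1) snd) // => j; by have [] := pp j.
(* Exchange of summation: [n u v] is counted in the slices [w <= u] of one axis and [w < v] of the
   other, whose colours make up [zmon]. *)
have S1 (f g : nat -> nat) (h : nat -> nat -> bool) :
   (\sum_(w < M) f w * \sum_(u < M | h w u) g u = \sum_(u < M) g u * \sum_(w < M) h w u * f w)%N.
  under eq_bigr do rewrite big_distrr big_mkcond.
  rewrite exchange_big; apply: eq_bigr => u _; rewrite big_distrr; apply: eq_bigr => w _ /=.
  by case: (h w u); rewrite ?mul1n ?mul0n ?muln0 // mulnC.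
under eq_bigr => w _ do rewrite (growth_size _ _ _ _ _ _ _ gr) big_geq_mkord.
rewrite (S1 cp (fun u => \sum_(0 <= v < M) n u v)%N (fun w u => w <= u)%N).
under [X in (_ + X)%N]eq_bigr => w _.
  rewrite (growth_size _ _ _ _ _ _ _ gr) exchange_big big_geq_mkord; over.
rewrite (S1 cm (fun v => \sum_(0 <= u < M) n u v)%N (fun w v => w < v)%N).
under eq_bigr do rewrite big_mkord big_distrl.
under [X in (_ + X)%N]eq_bigr do rewrite big_mkord big_distrl.
rewrite [X in (_ + X)%N]exchange_big -big_split; apply: eq_bigr => u _.
rewrite -big_split; apply: eq_bigr => v _ /=; rewrite zmonE mulnDr.
have := ltn_ord u; have := ltn_ord v => hv hu.
by rewrite (sum_ord_widen cp u.+1 M) // (sum_ord_widen cm v M) // ltnW.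
Qed.

End Weight.

(** * Counting *)

Lemma fills_of_plane s k P : is_PP s k P -> exists n, fills s k P n.
Proof.
case/boundary_of_plane => A [B [M [[pA pB AB sA sB nA nB] b]]].
have [G [n [gr GA GB]]] := growth_exists_of_boundary _ _ A B M pA pB AB sA sB nA nB.
by exists n, A, B, G, M.
Qed.

Lemma plane_of_fill s k n M :
  (forall u v, (M <= u)%N \/ (M <= v)%N -> n u v = 0%N) ->
  (forall u v, px s k u != py s k v -> (n u v <= 1)%N) ->
  exists P, is_PP s k P /\ fills s k P n.
Proof.
move=> n0 n1; have [G gr] := growth_exists_of_fill _ _ n M n0 n1.
have [cl nl] := gr.
have [|P [PP b]] := plane_of_boundary s k (fun u => G u 0%N) (fun v => G 0%N v) M.
  split=> // [u|v|u|v|u hu|v hv]; try by case: (cl u 0%N).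
  - by case: (cl 0%N v).
  - by case: (cl 0%N v).
  - by apply: nl; left.
  - by apply: nl; right.
by exists P; split=> //; exists (fun u => G u 0%N), (fun v => G 0%N v), G, M.
Qed.

Lemma fills_le1 s k P n u v : fills s k P n -> px s k u != py s k v -> (n u v <= 1)%N.
Proof. by case=> A [B [G [M [_ [cl _] _ _]]]]; apply: cell_le1 (cl u v). Qed.

Lemma galois_inj X X' x : (forall u, is_part (X u)) -> (forall u, is_part (X' u)) ->
  galois X x -> galois X' x -> forall u, X u = X' u.
Proof.
by move=> pX pX' g g' u; apply: part_ext => // j; apply: eq_by_lt => i; rewrite g g'.
Qed.

Lemma fills_fill_inj s k P n n' : fills s k P n -> fills s k P n' -> forall u v, n u v = n' u v.
Proof.
case=> A [B [G [M [[gA gB] gr GA GB]]]] [A' [B' [G' [M' [[gA' gB'] gr' GA' GB']]]]].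
have [cl _] := gr; have [cl' _] := gr'.
have eA u : G u 0%N = G' u 0%N.
  rewrite GA GA'; apply: (galois_inj _ _ _ _ _ gA gA') => w.
    by rewrite -GA; case: (cl w 0%N).
  by rewrite -GA'; case: (cl' w 0%N).
apply: (growth_fill_inj _ _ _ _ _ _ _ _ gr gr' eA) => -[|v]; first exact: eA.
rewrite GB GB'; apply: (galois_inj _ _ _ _ _ gB gB') => w.
  by rewrite -GB; case: (cl 0%N w.+1).
by rewrite -GB'; case: (cl' 0%N w.+1).
Qed.

Lemma fills_plane_inj s k P P' n : is_PP s k P -> is_PP s k P' ->
  fills s k P n -> fills s k P' n -> P = P'.
Proof.
move=> PP PP' [A [B [G [M [[gA gB] gr GA GB]]]]] [A' [B' [G' [M' [[gA' gB'] gr' GA' GB']]]]].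
have e := growth_boundary_inj _ _ _ _ _ _ _ _ gr gr' (fun _ _ => erefl).
apply: (bounds_inj s k P P' A B) => //; split.
  by move=> u j i; rewrite -gA' -GA' -e GA.
by move=> u j i; rewrite -gB' -GB' -e GB.
Qed.

Lemma sum_square_widen (f : nat -> nat -> nat) M K : (M <= K)%N ->
  (forall u v, (M <= u)%N \/ (M <= v)%N -> f u v = 0%N) ->
  (\sum_(u < M) \sum_(v < M) f u v = \sum_(u < K) \sum_(v < K) f u v)%N.
Proof.
move=> MK f0; rewrite (big_ord_widen K (fun u => \sum_(v < M) f u v)%N MK) big_mkcond.
apply: eq_bigr => u _; case: ltnP => hu; last first.
  by rewrite big1 // => v _; rewrite f0 //; left.
rewrite (big_ord_widen K (f u) MK) big_mkcond; apply: eq_bigr => v _.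
by case: ltnP => hv //; rewrite f0 //; right.
Qed.

Lemma sum_pairsL (f : nat -> nat -> nat) L : (forall u v, (L <= u + v)%N -> f u v = 0%N) ->
  (\sum_(x <- pairsL L) f x.2 x.1 = \sum_(u < L) \sum_(v < L) f u v)%N.
Proof.
move=> f0; rewrite big_filter big_mkcond big_allpairs exchange_big /=.
rewrite -{1}[L]subn0 -/(index_iota 0 L) big_mkord; apply: eq_bigr => u _.
rewrite -{1}[L]subn0 -/(index_iota 0 L) big_mkord; apply: eq_bigr => v _.
by case: ltnP => // h; rewrite f0 // addnC.
Qed.

Lemma pairsL_uniq L : uniq (pairsL L).
Proof. by rewrite filter_uniq // allpairs_uniq ?iota_uniq // => -[? ?] [? ?]. Qed.

Lemma mem_pairsL L a b : ((a, b) \in pairsL L) = (a + b < L)%N.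
Proof.
rewrite mem_filter /=; case: ltnP => //= h; apply/allpairsP; exists (a, b).
by rewrite !mem_iota; split=> //=; lia.
Qed.

(** [pairsL] lists [(a, b)] with [a] steps to the left of [k] and [b] to the right, so the cell
    [(u, v)] is stored under [(v, u)]. *)
Definition fill_of L (c : seq nat) u v :=
  if (u + v < L)%N then nth 0%N c (index (v, u) (pairsL L)) else 0%N.

Section Count.
Variables (N : nat) (s : int -> bool) (k : int) (d : mon N) (L : nat).
Hypotheses (N_gt0 : (0 < N)%N) (L_large : (mdeg N d <= L)%N).

Let e (x : nat * nat) := zmon N (k - x.1%:Z)%R (k + x.2%:Z)%R.
Let sg (x : nat * nat) := sigma s (k - x.1%:Z)%R (k + x.2%:Z)%R == 1%R.
Let sols := solutions N _ e sg (pairsL L) d.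

Lemma e_neq0 x : e x <> mzero N.
Proof. exact: zmon_neq0. Qed.

(** With this [e] and [sg], [geom] is convertible to [factor]. *)
Lemma rhs_partialE : rhs_partial N s k L d = (size sols)%:Z%R.
Proof. exact: (size_solutions N _ e sg e_neq0). Qed.

Lemma fill_of_nth c i : (i < size (pairsL L))%N ->
  fill_of L c (nth (0%N, 0%N) (pairsL L) i).2 (nth (0%N, 0%N) (pairsL L) i).1 = nth 0%N c i.
Proof.
move=> hi; have := mem_nth (0%N, 0%N) hi; have := index_uniq (0%N, 0%N) hi (pairsL_uniq L).
by case: (nth _ _ i) => a b /= ei; rewrite mem_pairsL /fill_of addnC ei => ->.
Qed.

Lemma sum_solution c t (n := fill_of L c) :
  (\sum_(i < size (pairsL L)) nth 0 c i * e (nth (0, 0) (pairsL L) i) t =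
   \sum_(u < L) \sum_(v < L) n u v * e (v : nat, u : nat) t)%N.
Proof.
rewrite -(sum_pairsL (fun u v => n u v * e (v, u) t)%N); last first.
  by move=> u v h; rewrite /n /fill_of ltnNge h.
rewrite (big_nth (0%N, 0%N)) big_mkord; apply: eq_bigr => i _.
by rewrite -fill_of_nth // -surjective_pairing.
Qed.

Lemma plane_of_solution c : c \in sols ->
  exists P, [/\ is_PP s k P, wtPP N k P = d & fills s k P (fill_of L c)].
Proof.
case/(mem_solutions N _ e sg e_neq0 (0%N, 0%N)) => sc ac wc.
have [u v|u v h|P [PP fl]] := plane_of_fill s k (fill_of L c) L.
- by move=> h; rewrite /fill_of; case: ltnP => //; lia.
- rewrite /fill_of; case: ltnP => // huv.
  have hi : (index (v, u) (pairsL L) < size (pairsL L))%N by rewrite index_mem mem_pairsL addnC.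
  have := ac _ hi; rewrite nth_index; last by rewrite mem_pairsL addnC.
  by rewrite /admissible /sg /= sigma_px_py (negbTE h).
exists P; split=> //; apply/ffunP => t.
have [M [nM ->]] := fills_weight N s k N_gt0 P _ PP fl.
rewrite wc sum_solution.
(* The array is supported below both [M] and [L], which are not comparable a priori; both sums are
   extended to the square of side [M + L]. *)
rewrite (sum_square_widen (fun u v => fill_of L c u v * e (v, u) t)%N M (M + L)) ?leq_addr //;
  last by move=> u v h; rewrite nM.
rewrite (sum_square_widen (fun u v => fill_of L c u v * e (v, u) t)%N L (M + L)) ?leq_addl //.
by move=> u v h; rewrite /fill_of; case: ltnP => //; lia.
Qed.

Lemma solution_of_plane P : is_PP s k P -> wtPP N k P = d ->
  exists2 c, c \in sols & fills s k P (fill_of L c).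
Proof.
move=> PP wP; have [n fl] := fills_of_plane s k P PP.
have [M [nM wM]] := fills_weight N s k N_gt0 P n PP fl.
(* A nonzero entry at [(u, v)] alone contributes degree at least [u + v + 1], which exceeds
   [mdeg N d] if [L <= u + v]. *)
have n0 u v : (L <= u + v)%N -> n u v = 0%N.
  move=> h; case: (posnP (n u v)) => // npos; exfalso.
  have [hu hv] : (u < M /\ v < M)%N.
    by split; rewrite ltnNge; apply/negP => hM; move: npos; rewrite nM //; [left|right].
  suff : mle N (e (v, u)) d by move/mdeg_le; rewrite mdeg_zmon //=; lia.
  apply/mleP => t; rewrite -wP wM (bigD1 (Ordinal hu)) //= (bigD1 (Ordinal hv)) //=.
  by rewrite -!addnA; apply: leq_trans (leq_addr _ _); rewrite leq_pmull.
pose c := [seq n x.2 x.1 | x <- pairsL L].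
have ec : fill_of L c = n.
  apply: functional_extensionality => u; apply: functional_extensionality => v.
  rewrite /fill_of; case: ltnP => h; last by rewrite n0.
  have hm : (v, u) \in pairsL L by rewrite mem_pairsL addnC.
  by rewrite (nth_map (0%N, 0%N)) ?index_mem // nth_index.
exists c; last by rewrite ec.
apply/(mem_solutions N _ e sg e_neq0 (0%N, 0%N)); split=> [|i hi|t]; first exact: size_map.
  rewrite (nth_map (0%N, 0%N)) // /admissible /sg sigma_px_py.
  case: eqP => //= /eqP h; exact: fills_le1 fl h.
rewrite sum_solution ec -wP wM.
rewrite (sum_square_widen (fun u v => n u v * e (v, u) t)%N M (M + L)) ?leq_addr //;
  last by move=> u v h; rewrite nM.
rewrite (sum_square_widen (fun u v => n u v * e (v, u) t)%N L (M + L)) ?leq_addl //.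
by move=> u v h; rewrite n0 //; lia.
Qed.

Lemma planes_of_weight : exists ps : seq plane,
  [/\ uniq ps, forall P, P \in ps <-> is_PP s k P /\ wtPP N k P = d &
    rhs_partial N s k L d = (size ps)%:Z%R].
Proof.
(* A plane partition is chosen for each solution; the list sought is the image of [sols]. *)
have F c : {P | c \in sols -> [/\ is_PP s k P, wtPP N k P = d & fills s k P (fill_of L c)]}.
  apply: constructive_indefinite_description.
  by case: (boolP (c \in sols)) => [/plane_of_solution [P h]|_]; [exists P | exists [::]].
exists [seq sval (F c) | c <- sols]; split; last by rewrite size_map rhs_partialE.
- rewrite map_inj_in_uniq ?solutions_uniq // => c c' hc hc' eP.
  have [PP _ fl] := svalP (F c) hc; have [_ _ fl'] := svalP (F c') hc'.
  rewrite -eP in fl'; have en := fills_fill_inj _ _ _ _ _ fl fl'.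
  move/(mem_solutions N _ e sg e_neq0 (0%N, 0%N)): hc => [sc _ _].
  move/(mem_solutions N _ e sg e_neq0 (0%N, 0%N)): hc' => [sc' _ _].
  apply: (@eq_from_nth _ 0%N); first by rewrite sc.
  by move=> i; rewrite sc => hi; rewrite -!fill_of_nth // en.
- move=> P; split=> [/mapP[c hc ->]|[PP wP]]; first by have [] := svalP (F c) hc.
  have [c hc fl] := solution_of_plane P PP wP; apply/mapP; exists c => //.
  have [PP' _ fl'] := svalP (F c) hc; exact: fills_plane_inj PP PP' fl fl'.
Qed.

End Count.

Local Open Scope ring_scope.

Theorem theorem7p6 (m n : nat) (s : int -> bool) (k : 'I_(m + n)) :
  m != n -> (3 <= m + n)%N ->
  (forall t : int, s (t + (m + n)%:Z)%R = s t) ->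
  count s [seq (i%:Z) | i <- iota 1 (m + n)] = m ->
  forall d : mon (m + n),
    exists2 ps : seq plane,
      uniq ps /\ (forall P : plane, P \in ps <-> is_PP s (k : nat)%:Z P /\ wtPP (m + n) (k : nat)%:Z P = d)
    & exists L0 : nat, forall L : nat, (L0 <= L)%N ->
        rhs_partial (m + n) s (k : nat)%:Z L d = (size ps)%:Z.
Proof.
move=> _ N3 _ _ d; have N0 : (0 < m + n)%N by lia.
(* The list is built at [L = mdeg d]. A larger [L] yields another duplicate-free list with the same
   members, hence of the same length. *)
have [ps [us mp _]] := planes_of_weight (m + n) s (k : nat)%:Z d _ N0 (leqnn _).
exists ps => //; exists (mdeg (m + n) d) => L hL.
have [ps' [us' mp' ->]] := planes_of_weight (m + n) s (k : nat)%:Z d L N0 hL.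
congr Posz; apply: perm_size; apply: uniq_perm => // P.
by apply/idP/idP => [/mp'/mp|/mp/mp'].
Qed.
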